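(* Let $L \xleftarrow{i_1} I \xrightarrow{i_2} R$ be a rewrite pattern. Then applying any of the rewrite $!$-box operations to it yields another rewrite pattern. That is: for every $b\in\,!(I)$, the spans $\mathrm{PCOPY}_b$, $\mathrm{PDROP}_b$ and $\mathrm{PKILL}_b$ of $L \xleftarrow{i_1} I \xrightarrow{i_2} R$ are rewrite patterns; and for all $b,b'\in\,!(I)$ such that $b,b'$ are mergable in $I$, $i_1(b),i_1(b')$ are mergable in $L$, and $i_2(b),i_2(b')$ are mergable in $R$, the span $\mathrm{PMERGE}_{b,b'}$ of $L \xleftarrow{i_1} I \xrightarrow{i_2} R$ is a rewrite pattern.
   Context: Graphs. $\mathbf{Graph}$ is the category of directed multigraphs: a graph has a set $E$ of edges, a set $V$ of vertices and functions $s,t:E\to V$ (source and target); loops and parallel edges are allowed. If $t(e)=v$ (resp. $s(e)=v$), $e$ is an in-edge (resp. out-edge) of $v$. $\mathrm{succ}(v)$ is the set of targets of out-edges of $v$, and $\mathrm{pred}(v)$ is the set of sources of in-edges of $v$. For a subgraph $H$ of $G$, $G\setminus H$ is the largest subgraph of $G$ disjoint from $H$ (delete all vertices of $H$ and all edges incident to them); $G\setminus b$ for a vertex $b$ means deleting the vertex $b$ and its incident edges. String graphs. $\mathcal G_2$ is the graph with two vertices $\eta$ (node-vertex type) and $\omega$ (wire-vertex type) and exactly three edges: one $\eta\to\omega$, one $\omega\to\eta$, one loop $\omega\to\omega$. A string graph is an object $(G,\tau:G\to\mathcal G_2)$ of $\mathbf{Graph}/\mathcal G_2$ in which each wire-vertex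 (a vertex sent to $\omega$) has at most one in-edge and at most one out-edge. $\mathcal G_3$-typed graphs. $\mathcal G_3$ is $\mathcal G_2$ together with a third vertex $!$, a loop $!\to !$, one edge $!\to\eta$ and one edge $!\to\omega$. A $\mathcal G_3$-typed graph is an object $(G,\tau)$ of $\mathbf{Graph}/\mathcal G_3$; $\eta(G),\omega(G),!(G)$ denote the sets of vertices of $G$ sent by $\tau$ to $\eta,\omega,!$. A wire-vertex is an input of $G$ if its only in-edges (if any) are from $!$-vertices, and an output if it has no out-edges; $\mathrm{In}(G)$, $\mathrm{Out}(G)$ are the sets of inputs and outputs. The boundary $\mathrm{Bound}(G)$ is the set of wire-vertices that are inputs or outputs. A wire-vertex of a string graph with no in-edges and no out-edges is an isolated point (it is both an input and an output); a string graph consisting only of isolated points is a point graph. A subgraph $O$ of $G$ is open if $\mathrm{In}(G\setminus O)\subseteq\mathrm{In}(G)$ and $\mathrm{Out}(G\setminus O)\subseteq\mathrm{Out}(G)$. For $b\in\,!(G)$, $B(b)$ is the full subgraph of $G$ with vertex set $\mathrm{succ}(b)$, and $B^\uparrow(b)$ is the full subgraph with vertex set $\mathrm{pred}(b)$. Pattern graphs. A $\mathcal G_3$-typed graph $G$ is a pattern graph if: (1) the full subgraph $\Sigma(G)$ on $\eta(G)\cup\omega(G)$ is a string graph; (2) the full subgraph $\beta(G)$ on $!(G)$ is posetal, i.e. it has at most one edge from any vertex to any other (or to itself) and the relation ''there is an edge from $x$ to $y$'' is a partial order (in particular reflexive); (3) for all $b\in\,!(G)$, $B(b)$ is an open subgraph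 of $G$; (4) for all $b,b'\in\,!(G)$, if $b'\in B(b)$ then $B(b')\subseteq B(b)$. Morphisms of pattern graphs are the morphisms of $\mathbf{Graph}/\mathcal G_3$; for such a morphism $f$, $\Sigma(f)$ and $\beta(f)$ denote its restrictions to $\Sigma$ and $\beta$ of domain and codomain. Operations on pattern graphs. For a pattern graph $G$ and $b\in\,!(G)$: $\mathrm{COPY}_b(G)$ is the pushout in $\mathbf{Graph}/\mathcal G_3$ of the inclusion $G\setminus B(b)\hookrightarrow G$ with itself; $\mathrm{DROP}_b(G):=G\setminus b$; $\mathrm{KILL}_b(G):=G\setminus B(b)$. Two $!$-vertices $b,b'$ of $G$ are mergable if $B^\uparrow(b)\setminus b=B^\uparrow(b')\setminus b'$ and $B(b)\cap B(b')=\varnothing$; then $\mathrm{MERGE}_{b,b'}(G)$ is the coequaliser in $\mathbf{Graph}/\mathcal G_3$ of $\hat b,\hat b':B^\uparrow(b)\to G$, where $\hat b$ is the inclusion and $\hat b'$ is the composite of the obvious isomorphism $B^\uparrow(b)\cong B^\uparrow(b')$ (sending $b$ to $b'$ and being the identity on $B^\uparrow(b)\setminus b$) with the inclusion $B^\uparrow(b')\hookrightarrow G$. Rewrite patterns. A rewrite pattern, written $L \to R$, is a span of pattern graphs $L \xleftarrow{i_1} I \xrightarrow{i_2} R$ such that: (1) $\Sigma(I)$ is a point graph; (2) $L$ and $R$ share the same boundary via $\Sigma(i_1)$ and $\Sigma(i_2)$: $i_1$ restricts to a bijection from the vertices of $\Sigma(I)$ to $\mathrm{Bound}(L)$, $i_2$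 restricts to a bijection from the vertices of $\Sigma(I)$ to $\mathrm{Bound}(R)$, and for all vertices $p$ of $\Sigma(I)$, $i_1(p)\in\mathrm{In}(L)\Leftrightarrow i_2(p)\in\mathrm{In}(R)$ and $i_1(p)\in\mathrm{Out}(L)\Leftrightarrow i_2(p)\in\mathrm{Out}(R)$; (3) $\beta(i_1)$ and $\beta(i_2)$ are graph isomorphisms; (4) for each $b\in\,!(I)$, the preimage of $B(i_1(b))$ under $i_1$ is exactly $B(b)$, and the preimage of $B(i_2(b))$ under $i_2$ is exactly $B(b)$. Operations on rewrite patterns. Let $L \xleftarrow{i_1} I \xrightarrow{i_2} R$ be a rewrite pattern and $b\in\,!(I)$. - $\mathrm{PCOPY}_b$ gives the span $\mathrm{COPY}_{i_1(b)}(L)\xleftarrow{i_1'}\mathrm{COPY}_b(I)\xrightarrow{i_2'}\mathrm{COPY}_{i_2(b)}(R)$. Here, with $p_1^I,p_2^I:I\to\mathrm{COPY}_b(I)$ and $p_1^L,p_2^L:L\to\mathrm{COPY}_{i_1(b)}(L)$ the pushout coprojections and $\iota:I\setminus B(b)\hookrightarrow I$ the inclusion, one has $p_1^L\circ i_1\circ\iota=p_2^L\circ i_1\circ\iota$, and $i_1'$ is the unique map induced by the pushout with $i_1'\circ p_k^I=p_k^L\circ i_1$ for $k=1,2$; $i_2'$ is defined in the same way with $R$ in place of $L$. - $\mathrm{PDROP}_b$ gives the span $\mathrm{DROP}_{i_1(b)}(L)\xleftarrow{i_1'}\mathrm{DROP}_b(I)\xrightarrow{i_2'}\mathrm{DROP}_{i_2(b)}(R)$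 with $i_1',i_2'$ the restrictions of $i_1,i_2$. - $\mathrm{PKILL}_b$ gives the span $\mathrm{KILL}_{i_1(b)}(L)\xleftarrow{i_1'}\mathrm{KILL}_b(I)\xrightarrow{i_2'}\mathrm{KILL}_{i_2(b)}(R)$ with $i_1',i_2'$ the restrictions of $i_1,i_2$. - For $b,b'\in\,!(I)$ mergable in $I$ such that $i_1(b),i_1(b')$ are mergable in $L$ and $i_2(b),i_2(b')$ are mergable in $R$, $\mathrm{PMERGE}_{b,b'}$ gives the span $\mathrm{MERGE}_{i_1(b),i_1(b')}(L)\xleftarrow{i_1'}\mathrm{MERGE}_{b,b'}(I)\xrightarrow{i_2'}\mathrm{MERGE}_{i_2(b),i_2(b')}(R)$, where $i_1'$ and $i_2'$ are the unique maps induced by the coequaliser $I\to\mathrm{MERGE}_{b,b'}(I)$ that commute with $i_1$, $i_2$ and the coequaliser maps out of $I$, $L$ and $R$. *)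

(* Defs.v *)
From mathcomp Require Import all_boot boolp classical_sets functions.
From Stdlib Require Import Relations.

Set Implicit Arguments.
Unset Strict Implicit.
Unset Printing Implicit Defensive.

Local Open Scope classical_set_scope.

Lemma sval_inj (X : Type) (P : X -> Prop) (u v : {x | P x}) :
  sval u = sval v -> u = v.
Proof. by case: u v => [x p] [y q] /= E; apply: eq_exist. Qed.

(* Graphs are directed multigraphs with arbitrary, possibly infinite, sets of
   vertices and edges. *)

Record graph := Graph {
  vert : Type;
  edge : Type;
  src : edge -> vert;
  tgt : edge -> vert }.

Arguments src {g} _.
Arguments tgt {g} _.

Record hom (G H : graph) := Hom {
  hv :> vert G -> vert H;
  he : edge G -> edge H;
  hom_src : forall e, src (he e) = hv (src e);
  hom_tgt : forall e, tgt (he e) = hv (tgt e) }.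

Lemma hom_eq (G H : graph) (f g : hom G H) :
  (forall v, f v = g v) -> (forall e, he f e = he g e) -> f = g.
Proof.
case: f g => fv fe fs ft [gv ge gs gt] /= /funext Ev /funext Ee; subst gv ge.
by congr Hom; apply: Prop_irrelevance.
Qed.

Definition hom_comp (G H K : graph) (g : hom H K) (f : hom G H) : hom G K.
Proof.
by refine (@Hom G K (fun v => g (f v)) (fun e => he g (he f e)) _ _) => e;
  rewrite ?hom_src ?hom_tgt.
Defined.

Definition graph_iso (G H : graph) (f : hom G H) : Prop :=
  exists g : hom H G, [/\ cancel f g, cancel g f,
    cancel (he f) (he g) & cancel (he g) (he f)].

Record tgraph (T : graph) := TGraph {
  tg :> graph;
  typ : hom tg T }.

Arguments typ {T} _.

(* Morphisms of the slice category Graph/T. *)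
Record thom (T : graph) (G H : tgraph T) := THom {
  th :> hom G H;
  thom_typ : hom_comp (typ H) th = typ G }.

Section Slice.
Variable T : graph.
Implicit Types G H K : tgraph T.

Lemma thom_typv G H (f : thom G H) v : typ H (f v) = typ G v.
Proof. by rewrite -(thom_typ f). Qed.

Lemma thom_type G H (f : thom G H) e : he (typ H) (he f e) = he (typ G) e.
Proof. by rewrite -(thom_typ f). Qed.

Lemma thom_eq G H (f g : thom G H) :
  (forall v, f v = g v) -> (forall e, he f e = he g e) -> f = g.
Proof.
case: f g => f tf [g tg0] /= Ev Ee.
have E : f = g by apply: hom_eq.
by subst g; congr THom; apply: Prop_irrelevance.
Qed.

Definition thom_comp G H K (g : thom H K) (f : thom G H) : thom G K.
Proof.
refine (@THom T G K (hom_comp g f) _).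
by apply: hom_eq => x /=; rewrite ?thom_typv ?thom_type.
Defined.

Record subgraph (G : graph) := Subgraph {
  sv : set (vert G);
  se : set (edge G);
  se_src : forall e, se e -> sv (src e);
  se_tgt : forall e, se e -> sv (tgt e) }.

Lemma subgraph_eq (G : graph) (H K : subgraph G) :
  sv H = sv K -> se H = se K -> H = K.
Proof.
case: H K => [v e s t] [v' e' s' t'] /= Ev Ee; subst v' e'.
by congr Subgraph; apply: Prop_irrelevance.
Qed.

Definition subgraph_le (G : graph) (H K : subgraph G) : Prop :=
  sv H `<=` sv K /\ se H `<=` se K.

Definition full (G : graph) (A : set (vert G)) : subgraph G.
Proof. by refine (@Subgraph G A [set e | A (src e) /\ A (tgt e)] _ _) => e []. Defined.

Definition del (G : graph) (H : subgraph G) (A : set (vert G)) : subgraph G.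
Proof.
refine (@Subgraph G (sv H `\` A)
  [set e | [/\ se H e, ~ A (src e) & ~ A (tgt e)]] _ _) => e [He Hs Ht].
- by split=> //; apply: se_src.
- by split=> //; apply: se_tgt.
Defined.

(* G \ H, the largest subgraph of G disjoint from H: an edge outside H with an
   endpoint in H is deleted too. *)
Definition minus (G : graph) (H : subgraph G) : subgraph G :=
  del (full setT) (sv H).

Definition minusv (G : graph) (b : vert G) : subgraph G :=
  del (full setT) [set b].

Definition preim (G H : graph) (f : hom G H) (K : subgraph H) : subgraph G.
Proof.
refine (@Subgraph G [set v | sv K (f v)] [set e | se K (he f e)] _ _) => e /= Ke.
- by rewrite -hom_src; apply: se_src.
- by rewrite -hom_tgt; apply: se_tgt.
Defined.

Definition sub_graph (G : graph) (H : subgraph G) : graph :=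
  @Graph {v | sv H v} {e | se H e}
    (fun e => exist _ (src (sval e)) (se_src (svalP e)))
    (fun e => exist _ (tgt (sval e)) (se_tgt (svalP e))).

Definition sub G (H : subgraph G) : tgraph T.
Proof.
by refine (@TGraph T (sub_graph H) (@Hom (sub_graph H) T
  (fun v => typ G (sval v)) (fun e => he (typ G) (sval e)) _ _)) => e;
  rewrite ?hom_src ?hom_tgt.
Defined.

Definition sub_incl G (H : subgraph G) : thom (sub H) G.
Proof.
unshelve refine (@THom T (sub H) G (@Hom (sub H) G
  (fun v => sval v) (fun e => sval e) _ _) _) => //.
Defined.

Definition restr G G' (f : thom G G') (H : subgraph G) (H' : subgraph G')
    (fH : subgraph_le H (preim f H')) : thom (sub H) (sub H').
Proof.
unshelve refine (@THom T (sub H) (sub H') (@Hom (sub H) (sub H')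
  (fun v => exist _ (f (sval v)) (fH.1 _ (svalP v)))
  (fun e => exist _ (he f (sval e)) (fH.2 _ (svalP e))) _ _) _) => [e|e|].
- by apply: eq_exist; rewrite hom_src.
- by apply: eq_exist; rewrite hom_tgt.
- by apply: hom_eq => x /=; rewrite ?thom_typv ?thom_type.
Defined.

(* Quotients of types by the equivalence relation generated by a relation,
   realised as sets of equivalence classes. *)

Section Quotient.
Variables (X : Type) (R : X -> X -> Prop).

Definition quot : Type :=
  {P : set X | exists x, P = clos_refl_sym_trans X R x}.

Definition quot_in (x : X) : quot := exist _ _ (ex_intro _ x erefl).

Definition quot_rep (q : quot) : X := sval (cid (svalP q)).

Lemma quot_repK q : quot_in (quot_rep q) = q.
Proof. by case: q => P p; apply: eq_exist; rewrite /quot_rep; case: cid. Qed.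

Lemma quot_inE x y : quot_in x = quot_in y <-> clos_refl_sym_trans X R x y.
Proof.
split=> [[->]|xy]; first exact: rst_refl.
apply: eq_exist; apply/predeqP => z; split=> h.
- exact: (rst_trans _ _ _ x _ (rst_sym _ _ _ _ xy) h).
- exact: (rst_trans _ _ _ y _ xy h).
Qed.

Definition quot_lift (Y : Type) (f : X -> Y) (q : quot) : Y := f (quot_rep q).

Lemma quot_liftE (Y : Type) (f : X -> Y) :
  (forall x y, R x y -> f x = f y) -> forall x, quot_lift f (quot_in x) = f x.
Proof.
move=> fR x; have fC a b : clos_refl_sym_trans X R a b -> f a = f b.
  by elim=> [a' b' /fR|//|a' b' _ ->|a' b' c _ -> _ ->].
by apply: fC; apply/quot_inE; apply: quot_repK.
Qed.

End Quotient.

Section Coequaliser.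
Variables (A G : tgraph T) (f g : thom A G).

Definition coeq_relv (v w : vert G) : Prop := exists a, f a = v /\ g a = w.
Definition coeq_rele (d e : edge G) : Prop := exists a, he f a = d /\ he g a = e.

Lemma coeq_src_rele d e : coeq_rele d e -> quot_in coeq_relv (src d) = quot_in coeq_relv (src e).
Proof.
move=> [a [<- <-]]; apply/quot_inE; apply: rst_step; exists (src a).
by rewrite !hom_src.
Qed.

Lemma coeq_tgt_rele d e : coeq_rele d e -> quot_in coeq_relv (tgt d) = quot_in coeq_relv (tgt e).
Proof.
move=> [a [<- <-]]; apply/quot_inE; apply: rst_step; exists (tgt a).
by rewrite !hom_tgt.
Qed.

Definition coeq_graph : graph :=
  @Graph (quot coeq_relv) (quot coeq_rele)
    (quot_lift (fun e => quot_in coeq_relv (src e)))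
    (quot_lift (fun e => quot_in coeq_relv (tgt e))).

Definition coeq_in_hom : hom G coeq_graph.
Proof.
refine (@Hom G coeq_graph (quot_in coeq_relv) (quot_in coeq_rele) _ _) => e.
- exact: (quot_liftE coeq_src_rele).
- exact: (quot_liftE coeq_tgt_rele).
Defined.

Section Desc.
Variables (K : graph) (h : hom G K).
Hypothesis hfg : hom_comp h f = hom_comp h g.

Lemma coeq_desc_relv v w : coeq_relv v w -> h v = h w.
Proof. by move=> [a [<- <-]]; have := congr1 (fun k : hom A K => k a) hfg. Qed.

Lemma coeq_desc_rele d e : coeq_rele d e -> he h d = he h e.
Proof. by move=> [a [<- <-]]; have := congr1 (fun k : hom A K => he k a) hfg. Qed.

Definition coeq_desc_hom : hom coeq_graph K.
Proof.
refine (@Hom coeq_graph K (quot_lift h) (quot_lift (he h)) _ _) => q;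
  rewrite -(quot_repK q) (quot_liftE coeq_desc_rele).
- by rewrite (hom_src coeq_in_hom) (quot_liftE coeq_desc_relv) hom_src.
- by rewrite (hom_tgt coeq_in_hom) (quot_liftE coeq_desc_relv) hom_tgt.
Defined.

Lemma coeq_desc_homK : hom_comp coeq_desc_hom coeq_in_hom = h.
Proof. by apply: hom_eq => x; [exact: (quot_liftE coeq_desc_relv)|exact: (quot_liftE coeq_desc_rele)]. Qed.

End Desc.

Lemma coeq_hom_ext (K : graph) (h k : hom coeq_graph K) :
  hom_comp h coeq_in_hom = hom_comp k coeq_in_hom -> h = k.
Proof.
move=> E; apply: hom_eq => q; rewrite -(quot_repK q).
- exact: (congr1 (fun l : hom G K => l (quot_rep q)) E).
- exact: (congr1 (fun l : hom G K => he l (quot_rep q)) E).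
Qed.

Lemma coeq_typ : hom_comp (typ G) f = hom_comp (typ G) g.
Proof. by rewrite !thom_typ. Qed.

Definition coeq : tgraph T := @TGraph T coeq_graph (coeq_desc_hom coeq_typ).

Definition coeq_in : thom G coeq :=
  @THom T G coeq coeq_in_hom (coeq_desc_homK coeq_typ).

Lemma coeq_in_eq : thom_comp coeq_in f = thom_comp coeq_in g.
Proof. by apply: thom_eq => a; apply/quot_inE; apply: rst_step; exists a. Qed.

Lemma coeq_desc_eq (K : tgraph T) (h : thom G K) :
  thom_comp h f = thom_comp h g -> hom_comp h f = hom_comp h g.
Proof. by move=> E; apply: (congr1 (@th T A K) E). Qed.

Lemma coeq_desc_typ (K : tgraph T) (h : thom G K)
  (hfg : thom_comp h f = thom_comp h g) :
  hom_comp (typ K) (coeq_desc_hom (coeq_desc_eq hfg)) = typ coeq.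
Proof.
apply: coeq_hom_ext; rewrite (coeq_desc_homK coeq_typ) -(thom_typ h).
have D := coeq_desc_homK (coeq_desc_eq hfg); apply: hom_eq => x.
- exact: (congr1 (fun l : hom G K => typ K (l x)) D).
- exact: (congr1 (fun l : hom G K => he (typ K) (he l x)) D).
Qed.

Definition coeq_desc (K : tgraph T) (h : thom G K)
  (hfg : thom_comp h f = thom_comp h g) : thom coeq K :=
  @THom T coeq K (coeq_desc_hom (coeq_desc_eq hfg)) (coeq_desc_typ hfg).

Lemma coeq_descK (K : tgraph T) (h : thom G K)
  (hfg : thom_comp h f = thom_comp h g) :
  thom_comp (coeq_desc hfg) coeq_in = h.
Proof.
have D := coeq_desc_homK (coeq_desc_eq hfg); apply: thom_eq => x.
- exact: (congr1 (fun l : hom G K => l x) D).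
- exact: (congr1 (fun l : hom G K => he l x) D).
Qed.

Lemma coeq_desc_uniq (K : tgraph T) (h k : thom coeq K) :
  thom_comp h coeq_in = thom_comp k coeq_in -> h = k.
Proof.
move=> E; have E' : th h = th k.
  exact: (coeq_hom_ext (congr1 (@th T G K) E)).
by apply: thom_eq => x; rewrite E'.
Qed.

Lemma coeq_univ (K : tgraph T) (h : thom G K) :
  thom_comp h f = thom_comp h g ->
  exists! u : thom coeq K, thom_comp u coeq_in = h.
Proof.
move=> E; exists (coeq_desc E); split=> [|u uE]; first exact: coeq_descK.
by apply: coeq_desc_uniq; rewrite coeq_descK uE.
Qed.

End Coequaliser.

Definition coprod_graph (G H : graph) : graph :=
  @Graph (vert G + vert H) (edge G + edge H)
    (fun e => match e with inl d => inl (src d) | inr d => inr (src d) end)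
    (fun e => match e with inl d => inl (tgt d) | inr d => inr (tgt d) end).

Definition coprod_desc_hom (G H K : graph) (f : hom G K) (g : hom H K) :
  hom (coprod_graph G H) K.
Proof.
by refine (@Hom (coprod_graph G H) K
  (fun v => match v with inl w => f w | inr w => g w end)
  (fun e => match e with inl d => he f d | inr d => he g d end) _ _) => -[] d;
  rewrite ?hom_src ?hom_tgt.
Defined.

Definition coprod G H : tgraph T :=
  @TGraph T (coprod_graph G H) (coprod_desc_hom (typ G) (typ H)).

Definition coprod_inl G H : thom G (coprod G H).
Proof.
unshelve refine (@THom T G (coprod G H) (@Hom G (coprod G H) inl inl _ _) _) => //.
exact: hom_eq.
Defined.

Definition coprod_inr G H : thom H (coprod G H).
Proof.
unshelve refine (@THom T H (coprod G H) (@Hom H (coprod G H) inr inr _ _) _) => //.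
exact: hom_eq.
Defined.

Definition coprod_desc G H K (f : thom G K) (g : thom H K) :
  thom (coprod G H) K.
Proof.
refine (@THom T (coprod G H) K (coprod_desc_hom f g) _).
by apply: hom_eq => -[] x /=; rewrite ?thom_typv ?thom_type.
Defined.

Section Pushout.
Variables (A G H : tgraph T) (f : thom A G) (g : thom A H).

Definition pushout_legl := thom_comp (coprod_inl G H) f.
Definition pushout_legr := thom_comp (coprod_inr G H) g.

Definition pushout : tgraph T := coeq pushout_legl pushout_legr.

Definition pushout_in1 : thom G pushout :=
  thom_comp (coeq_in pushout_legl pushout_legr) (coprod_inl G H).

Definition pushout_in2 : thom H pushout :=
  thom_comp (coeq_in pushout_legl pushout_legr) (coprod_inr G H).

Lemma pushout_eq : thom_comp pushout_in1 f = thom_comp pushout_in2 g.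
Proof.
have E := coeq_in_eq pushout_legl pushout_legr; apply: thom_eq => a.
- exact: (congr1 (fun l : thom A _ => l a) E).
- exact: (congr1 (fun l : thom A _ => he l a) E).
Qed.

Lemma pushout_desc_eq (K : tgraph T) (h : thom G K) (k : thom H K) :
  thom_comp h f = thom_comp k g ->
  thom_comp (coprod_desc h k) pushout_legl = thom_comp (coprod_desc h k) pushout_legr.
Proof.
move=> E; apply: thom_eq => a.
- exact: (congr1 (fun l : thom A K => l a) E).
- exact: (congr1 (fun l : thom A K => he l a) E).
Qed.

Definition pushout_desc (K : tgraph T) (h : thom G K) (k : thom H K)
  (E : thom_comp h f = thom_comp k g) : thom pushout K :=
  coeq_desc (pushout_desc_eq E).

Lemma pushout_desc1 (K : tgraph T) (h : thom G K) (k : thom H K)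
  (E : thom_comp h f = thom_comp k g) :
  thom_comp (pushout_desc E) pushout_in1 = h.
Proof.
have D := coeq_descK (pushout_desc_eq E); apply: thom_eq => a.
- exact: (congr1 (fun l : thom (coprod G H) K => l (inl a)) D).
- exact: (congr1 (fun l : thom (coprod G H) K => he l (inl a)) D).
Qed.

Lemma pushout_desc2 (K : tgraph T) (h : thom G K) (k : thom H K)
  (E : thom_comp h f = thom_comp k g) :
  thom_comp (pushout_desc E) pushout_in2 = k.
Proof.
have D := coeq_descK (pushout_desc_eq E); apply: thom_eq => a.
- exact: (congr1 (fun l : thom (coprod G H) K => l (inr a)) D).
- exact: (congr1 (fun l : thom (coprod G H) K => he l (inr a)) D).
Qed.

Lemma pushout_univ (K : tgraph T) (h : thom G K) (k : thom H K) :
  thom_comp h f = thom_comp k g ->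
  exists! u : thom pushout K,
    thom_comp u pushout_in1 = h /\ thom_comp u pushout_in2 = k.
Proof.
move=> E; exists (pushout_desc E); split.
  by split; [exact: pushout_desc1|exact: pushout_desc2].
move=> u [u1 u2]; apply: coeq_desc_uniq; apply: thom_eq => -[] a.
- exact: (congr1 (fun l : thom G K => l a) (etrans (pushout_desc1 E) (esym u1))).
- exact: (congr1 (fun l : thom H K => l a) (etrans (pushout_desc2 E) (esym u2))).
- exact: (congr1 (fun l : thom G K => he l a) (etrans (pushout_desc1 E) (esym u1))).
- exact: (congr1 (fun l : thom H K => he l a) (etrans (pushout_desc2 E) (esym u2))).
Qed.

End Pushout.

End Slice.

Variant vtype2 := Node | Wire.
Variant etype2 := NodeWire | WireNode | WireWire.

Definition G2 : graph :=
  @Graph vtype2 etype2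
    (fun e => match e with NodeWire => Node | WireNode => Wire | WireWire => Wire end)
    (fun e => match e with NodeWire => Wire | WireNode => Node | WireWire => Wire end).

Variant vtype3 := Old of vtype2 | Bang.
Variant etype3 := OldE of etype2 | BangBang | BangNode | BangWire.

Definition G3 : graph :=
  @Graph vtype3 etype3
    (fun e => match e with OldE d => Old (@src G2 d) | _ => Bang end)
    (fun e => match e with
              | OldE d => Old (@tgt G2 d)
              | BangBang => Bang
              | BangNode => Old Node
              | BangWire => Old Wire
              end).

Definition string_graph (G : tgraph G2) : Prop :=
  forall v : vert G, typ G v = Wire ->
    (forall d e : edge G, tgt d = v -> tgt e = v -> d = e) /\
    (forall d e : edge G, src d = v -> src e = v -> d = e).

Definition isolated_point (G : tgraph G2) (v : vert G) : Prop :=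
  [/\ typ G v = Wire, forall e : edge G, tgt e <> v
    & forall e : edge G, src e <> v].

Definition point_graph (G : tgraph G2) : Prop :=
  string_graph G /\ forall v : vert G, isolated_point v.

Section Typed3.
Implicit Types G H : tgraph G3.

Unset Implicit Arguments.

Definition etas G : set (vert G) := [set v | typ G v = Old Node].
Definition omegas G : set (vert G) := [set v | typ G v = Old Wire].
Definition bangs G : set (vert G) := [set v | typ G v = Bang].
Definition sigma_verts G : set (vert G) := etas G `|` omegas G.

Set Implicit Arguments.

(* Left inverses of the inclusion of G2 into G3.  Sigma G is retyped over G2
   through them; no vertex or edge of Sigma G is sent to a default value. *)
Definition unOld (t : vtype3) : vtype2 := if t is Old u then u else Wire.
Definition unOldE (t : etype3) : etype2 := if t is OldE u then u else WireWire.

Lemma sigma_vertsP G v : sigma_verts G v <-> typ G v = Old (unOld (typ G v)).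
Proof.
by rewrite /sigma_verts /= /etas /omegas /=; case: (typ G v) => [[]|] /=;
  split=> //; [left|right|case].
Qed.

Definition Sigma G : tgraph G2.
Proof.
refine (@TGraph G2 (sub_graph (full (sigma_verts G)))
  (@Hom (sub_graph (full (sigma_verts G))) G2
    (fun v => unOld (typ G (sval v))) (fun e => unOldE (he (typ G) (sval e))) _ _));
move=> [e [/= /sigma_vertsP + /sigma_vertsP +]];
by rewrite -!hom_src -!hom_tgt; case: (he (typ G) e).
Defined.

Definition beta G : tgraph G3 := sub (full (bangs G)).

Lemma bangs_hom G H (f : thom G H) v : bangs H (f v) <-> bangs G v.
Proof. by rewrite /bangs /= thom_typv. Qed.

Lemma beta_restr G H (f : thom G H) :
  subgraph_le (full (bangs G)) (preim f (full (bangs H))).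
Proof.
by split=> [v /bangs_hom|e] //= [/(bangs_hom f) + /(bangs_hom f)];
  rewrite -hom_src -hom_tgt.
Qed.

Definition beta_map G H (f : thom G H) : thom (beta G) (beta H) :=
  restr (beta_restr f).

Unset Implicit Arguments.

Definition In G : set (vert G) :=
  [set v | omegas G v /\ forall e : edge G, tgt e = v -> bangs G (src e)].

Definition Out G : set (vert G) :=
  [set v | omegas G v /\ forall e : edge G, src e <> v].

Definition Bound G : set (vert G) := In G `|` Out G.

Set Implicit Arguments.

Definition open_subgraph G (O : subgraph G) : Prop :=
  [set sval v | v in In (sub (minus O))] `<=` In G /\
  [set sval v | v in Out (sub (minus O))] `<=` Out G.

Definition edge_rel (G : graph) (v w : vert G) : Prop :=
  exists e : edge G, src e = v /\ tgt e = w.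

Definition succs (G : graph) (v : vert G) : set (vert G) := [set w | edge_rel v w].
Definition preds (G : graph) (v : vert G) : set (vert G) := [set u | edge_rel u v].

Definition posetal (G : graph) : Prop :=
  [/\ forall d e : edge G, src d = src e -> tgt d = tgt e -> d = e,
      forall v : vert G, edge_rel v v,
      forall v w : vert G, edge_rel v w -> edge_rel w v -> v = w
    & forall u v w : vert G, edge_rel u v -> edge_rel v w -> edge_rel u w].

Definition B G (b : vert G) : subgraph G := full (succs b).
Definition Bup G (b : vert G) : subgraph G := full (preds b).

Definition pattern_graph G : Prop :=
  [/\ string_graph (Sigma G),
      posetal (beta G),
      forall b : vert G, bangs G b -> open_subgraph (B b)
    & forall b b' : vert G, bangs G b -> bangs G b' ->
        sv (B b) b' -> subgraph_le (B b') (B b)].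

Definition COPY G (b : vert G) : tgraph G3 :=
  pushout (sub_incl (minus (B b))) (sub_incl (minus (B b))).

Definition copy_in1 G (b : vert G) : thom G (COPY b) := pushout_in1 _ _.
Definition copy_in2 G (b : vert G) : thom G (COPY b) := pushout_in2 _ _.

Definition DROP G (b : vert G) : tgraph G3 := sub (minusv b).

Definition KILL G (b : vert G) : tgraph G3 := sub (minus (B b)).

Definition mergable G (b b' : vert G) : Prop :=
  [/\ bangs G b, bangs G b',
      del (Bup b) [set b] = del (Bup b') [set b']
    & sv (B b) `&` sv (B b') = set0].

Definition is_Bup_iso G (b b' : vert G)
    (phi : thom (sub (Bup b)) (sub (Bup b'))) : Prop :=
  [/\ graph_iso phi,
      forall v, sval v = b -> sval (phi v) = b',
      forall v, sval v <> b -> sval (phi v) = sval v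
    & forall e, src (sval e) <> b -> tgt (sval e) <> b ->
        sval (he phi e) = sval e].

End Typed3.

Section Bup_iso.
Implicit Types G H : tgraph G3.

Lemma src_bangs G (e : edge G) : bangs G (tgt e) -> bangs G (src e).
Proof. by rewrite /bangs /= -hom_src -hom_tgt; case: (he (typ G) e). Qed.

Lemma preds_bangs G (b v : vert G) : bangs G b -> preds b v -> bangs G v.
Proof. by move=> hb [e [<- eb]]; apply: src_bangs; rewrite eb. Qed.

Lemma beta_edge_rel G (v w : vert (beta G)) :
  edge_rel v w <-> edge_rel (sval v) (sval w).
Proof.
split=> [[e [<- <-]]|[e [ev ew]]]; first by exists (sval e).
have Pe : se (full (bangs G)) e.
  by split; rewrite /= ?ev ?ew; apply: svalP.
exists (exist _ e Pe : edge (beta G)).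
by case: v w ev ew => [v ?] [w ?] /= ev ew; split; apply: eq_exist.
Qed.

Lemma bang_edge_eq G (d e : edge G) : pattern_graph G ->
  bangs G (tgt d) -> src d = src e -> tgt d = tgt e -> d = e.
Proof.
move=> [_ [uE _ _ _] _ _] bt es et.
have Pd : se (full (bangs G)) d by split=> //=; apply: src_bangs.
have Pe : se (full (bangs G)) e by split=> /=; rewrite -?es -?et //; apply: src_bangs.
suff E : exist _ d Pd = exist _ e Pe :> edge (beta G) by exact: (congr1 sval E).
by apply: uE; apply: eq_exist.
Qed.

Lemma bang_refl G (b : vert G) : pattern_graph G -> bangs G b -> edge_rel b b.
Proof.
by move=> [_ [_ rE _ _] _ _] hb; have /beta_edge_rel := rE (exist _ b hb).
Qed.

Lemma bang_anti G (v w : vert G) : pattern_graph G -> bangs G w ->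
  edge_rel v w -> edge_rel w v -> v = w.
Proof.
move=> [_ [_ _ aE _] _ _] hw vw wv.
have hv : bangs G v by apply: preds_bangs hw vw.
suff E : exist _ v hv = exist _ w hw :> vert (beta G) by exact: (congr1 sval E).
by apply: aE; apply/beta_edge_rel.
Qed.

Lemma mergable_sym G (b b' : vert G) : mergable b b' -> mergable b' b.
Proof. by move=> [hb hb' E D]; split=> //; rewrite setIC. Qed.

Lemma mergable_preds G (b b' v : vert G) : mergable b b' ->
  preds b v -> v <> b -> preds b' v /\ v <> b'.
Proof.
move=> [_ _ E _] bv nv.
have : sv (del (Bup b) [set b]) v by [].
by rewrite E => -[].
Qed.

Section Construction.
Variables (G : tgraph G3) (pG : pattern_graph G).

Definition swap (b b' v : vert G) : vert G := if pselect (v = b) then b' else v.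

Lemma swapE b b' : swap b b' b = b'.
Proof. by rewrite /swap; case: pselect. Qed.

Lemma swapN b b' v : v <> b -> swap b b' v = v.
Proof. by rewrite /swap; case: pselect. Qed.

Lemma swap_preds b b' v : mergable b b' -> preds b v -> preds b' (swap b b' v).
Proof.
move=> m bv; have [->|nv] := pselect (v = b).
- by rewrite swapE; have [_ hb' _ _] := m; apply: (bang_refl pG).
- by rewrite swapN //; have [] := mergable_preds m bv nv.
Qed.

Lemma swapK b b' v : mergable b b' -> preds b v -> swap b' b (swap b b' v) = v.
Proof.
move=> m bv; have [->|nv] := pselect (v = b); first by rewrite !swapE.
by rewrite (swapN _ nv) swapN //; have [] := mergable_preds m bv nv.
Qed.

Lemma swap_edge (b b' : vert G) (e : edge (sub (Bup b))) : mergable b b' ->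
  exists d : edge (sub (Bup b')),
    src (sval d) = swap b b' (src (sval e)) /\
    tgt (sval d) = swap b b' (tgt (sval e)).
Proof.
case: e => e [/= es et] m.
have [hb hb' _ _] := m.
have Ps := swap_preds m es; have Pt := swap_preds m et.
have : edge_rel (swap b b' (src e)) (swap b b' (tgt e)).
  case: (pselect (tgt e = b)) => [->|nt]; first by rewrite swapE.
  rewrite (swapN _ nt) swapN; first by exists e.
  move=> esb; apply: nt; apply: (bang_anti pG hb et).
  by exists e.
move=> [d [ds dt]].
have Pd : se (Bup b') d by split; rewrite /= ?ds ?dt.
by exists (exist _ d Pd).
Qed.

Lemma Bup_edge_eq (b : vert G) (d e : edge (sub (Bup b))) : bangs G b ->
  src (sval d) = src (sval e) -> tgt (sval d) = tgt (sval e) -> d = e.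
Proof.
move: d e => [d Pd] [e Pe] /= hb es et; apply: eq_exist.
by apply: (bang_edge_eq pG) => //; apply: preds_bangs hb _; case: Pd.
Qed.

Lemma Bup_typ (b : vert G) (e : edge (sub (Bup b))) : bangs G b ->
  he (typ G) (sval e) = BangBang.
Proof.
move=> hb; have := preds_bangs hb (svalP e).2.
by rewrite /bangs /= -hom_tgt; case: (he _ _) => // -[].
Qed.

Definition swap_hom (b b' : vert G) (m : mergable b b') : thom (sub (Bup b)) (sub (Bup b')).
Proof.
unshelve refine (@THom G3 (@sub G3 G (Bup b)) (@sub G3 G (Bup b'))
  (@Hom (@sub G3 G (Bup b)) (@sub G3 G (Bup b'))
  (fun v => exist _ (swap b b' (sval v)) (swap_preds m (svalP v)))
  (fun e => sval (cid (swap_edge e m))) _ _) _) => [e|e|].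
- by apply: eq_exist; case: cid => d [].
- by apply: eq_exist; case: cid => d [].
have [hb hb' _ _] := m.
apply: hom_eq => [[v bv]|e] /=; last by rewrite !Bup_typ.
have -> : typ G (swap b b' v) = Bang.
  by apply: (preds_bangs hb'); apply: swap_preds.
by have -> : typ G v = Bang by apply: (preds_bangs hb bv).
Defined.

Lemma swap_homv (b b' : vert G) (m : mergable b b') v :
  sval (swap_hom m v) = swap b b' (sval v).
Proof. by []. Qed.

Lemma swap_homK (b b' : vert G) (m : mergable b b') (m' : mergable b' b) :
  cancel (swap_hom m) (swap_hom m') /\ cancel (he (swap_hom m)) (he (swap_hom m')).
Proof.
have Kv : cancel (swap_hom m) (swap_hom m').
  move=> v; apply: sval_inj.
  by rewrite !swap_homv swapK //; apply: (svalP v).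
have [hb _ _ _] := m; split=> // e; apply: Bup_edge_eq => //.
- have /= := congr1 sval (hom_src (hom_comp (swap_hom m') (swap_hom m)) e).
  by move=> ->; apply: swapK => //; case: (svalP e).
- have /= := congr1 sval (hom_tgt (hom_comp (swap_hom m') (swap_hom m)) e).
  by move=> ->; apply: swapK => //; case: (svalP e).
Qed.

Lemma Bup_iso_ex (b b' : vert G) (m : mergable b b') :
  exists phi : thom (sub (Bup b)) (sub (Bup b')), is_Bup_iso phi.
Proof.
have m' := mergable_sym m; have [hb hb' _ _] := m.
exists (swap_hom m); split.
- have [K1 K2] := swap_homK m m'; have [K1' K2'] := swap_homK m' m.
  by exists (swap_hom m').
- by move=> v E; rewrite swap_homv E swapE.
- by move=> v N; rewrite swap_homv swapN.
- move=> e Ns Nt; apply: (bang_edge_eq pG).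
  + exact: (preds_bangs hb' (svalP (he (swap_hom m) e)).2).
  + have /= -> := congr1 sval (hom_src (swap_hom m) e).
    by apply: swapN.
  + have /= -> := congr1 sval (hom_tgt (swap_hom m) e).
    by apply: swapN.
Qed.

Definition Bup_iso (b b' : vert G) (m : mergable b b') :
  thom (sub (Bup b)) (sub (Bup b')) := sval (cid (Bup_iso_ex m)).

Lemma Bup_isoP (b b' : vert G) (m : mergable b b') : is_Bup_iso (Bup_iso m).
Proof. exact: (svalP (cid (Bup_iso_ex m))). Qed.

Definition hat1 (b b' : vert G) (m : mergable b b') : thom (sub (Bup b)) G :=
  sub_incl (Bup b).

Definition hat2 (b b' : vert G) (m : mergable b b') : thom (sub (Bup b)) G :=
  thom_comp (sub_incl (Bup b')) (Bup_iso m).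

Definition MERGE (b b' : vert G) (m : mergable b b') : tgraph G3 :=
  coeq (hat1 m) (hat2 m).

Definition merge_in (b b' : vert G) (m : mergable b b') : thom G (MERGE m) :=
  coeq_in (hat1 m) (hat2 m).

End Construction.

End Bup_iso.

Section Induced.
Variables (G H : tgraph G3) (f : thom G H).

Definition preserves_B (b : vert G) : Prop := preim f (B (f b)) = B b.

Lemma minus_B_restr b : preserves_B b ->
  subgraph_le (minus (B b)) (preim f (minus (B (f b)))).
Proof.
move=> E; have NE v : ~ sv (B b) v -> ~ sv (B (f b)) (f v) by rewrite -E.
by split=> [v [_ /NE]|e [_ /NE + /NE]] //=; rewrite -?hom_src -?hom_tgt.
Qed.

Lemma copy_map_eq b : preserves_B b ->
  thom_comp (thom_comp (copy_in1 (f b)) f) (sub_incl (minus (B b))) =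
  thom_comp (thom_comp (copy_in2 (f b)) f) (sub_incl (minus (B b))).
Proof.
move=> E; set g := restr (minus_B_restr E).
have P := pushout_eq (sub_incl (minus (B (f b)))) (sub_incl (minus (B (f b)))).
apply: thom_eq => x.
- exact: (congr1 (fun l : thom (sub (minus (B (f b)))) _ => l (g x)) P).
- exact: (congr1 (fun l : thom (sub (minus (B (f b)))) _ => he l (he g x)) P).
Qed.

Definition copy_map b (E : preserves_B b) : thom (COPY b) (COPY (f b)) :=
  pushout_desc (copy_map_eq E).

Lemma copy_mapP b (E : preserves_B b) (u : thom (COPY b) (COPY (f b))) :
  thom_comp u (copy_in1 b) = thom_comp (copy_in1 (f b)) f /\
  thom_comp u (copy_in2 b) = thom_comp (copy_in2 (f b)) f <->
  u = copy_map E.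
Proof.
split=> [h|->]; last by split; [exact: pushout_desc1|exact: pushout_desc2].
have [w [_ wU]] := pushout_univ (copy_map_eq E).
rewrite -(wU _ h); apply: wU.
by split; [exact: pushout_desc1|exact: pushout_desc2].
Qed.

Definition kill_map b (E : preserves_B b) : thom (KILL b) (KILL (f b)) :=
  restr (minus_B_restr E).

Hypothesis isof : graph_iso (beta_map f).

Lemma beta_iso_inj (b v : vert G) : bangs G b -> f v = f b -> v = b.
Proof.
move=> hb E; have hv : bangs G v by apply/(bangs_hom f); rewrite E; apply/bangs_hom.
have [g [/can_inj inj _ _ _]] := isof.
suff E' : exist _ v hv = exist _ b hb :> vert (beta G) by exact: (congr1 sval E').
by apply: inj; apply: eq_exist.
Qed.

Lemma minusv_restr b : bangs G b ->
  subgraph_le (minusv b) (preim f (minusv (f b))).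
Proof.
move=> hb; split=> [v [_ nv]|e [_ ns nt]].
  by split=> // /(beta_iso_inj hb).
by split; rewrite /= ?hom_src ?hom_tgt // => /(beta_iso_inj hb).
Qed.

Definition drop_map b (hb : bangs G b) : thom (DROP b) (DROP (f b)) :=
  restr (minusv_restr hb).

Hypotheses (pG : pattern_graph G) (pH : pattern_graph H).

Lemma preds_hom b v : preds b v -> preds (f b) (f v).
Proof.
by move=> [e [<- <-]]; exists (he f e); rewrite hom_src hom_tgt.
Qed.

Lemma Bup_restr b : subgraph_le (Bup b) (preim f (Bup (f b))).
Proof.
split=> [v /preds_hom //|e [/preds_hom es /preds_hom et]].
by split; rewrite /= ?hom_src ?hom_tgt.
Qed.

Lemma hat2_map b b' (m : mergable b b') (mf : mergable (f b) (f b')) :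
  thom_comp f (hat2 pG m) = thom_comp (hat2 pH mf) (restr (Bup_restr b)).
Proof.
have [_ m1 m2 _] := Bup_isoP pG m; have [_ n1 n2 _] := Bup_isoP pH mf.
have [hb hb' _ _] := m.
set l := thom_comp _ _; set r := thom_comp _ _.
have lr v : l v = r v.
  rewrite /l /r /=; case: (pselect (sval v = b)) => E.
    by rewrite m1 // n1 //= E.
  by rewrite m2 // n2 //= => /(beta_iso_inj hb).
apply: thom_eq => // e; apply: (bang_edge_eq pH); last 2 first.
- by rewrite !hom_src lr.
- by rewrite !hom_tgt lr.
- rewrite hom_tgt; apply/(bangs_hom f); apply: (preds_bangs hb').
  exact: (svalP (Bup_iso pG m (tgt e))).
Qed.

Lemma merge_map_eq b b' (m : mergable b b') (mf : mergable (f b) (f b')) :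
  thom_comp (thom_comp (merge_in pH mf) f) (hat1 m) =
  thom_comp (thom_comp (merge_in pH mf) f) (hat2 pG m).
Proof.
have E1 := coeq_in_eq (hat1 mf) (hat2 pH mf).
have E2 := hat2_map m mf.
set g := restr (Bup_restr b) in E2.
apply: thom_eq => x.
- transitivity (thom_comp (merge_in pH mf) (hat2 pH mf) (g x)).
    exact: (congr1 (fun l : thom (sub (Bup (f b))) _ => l (g x)) E1).
  exact: (congr1 (fun l : thom (sub (Bup b)) H => merge_in pH mf (l x)) (esym E2)).
- transitivity (he (thom_comp (merge_in pH mf) (hat2 pH mf)) (he g x)).
    exact: (congr1 (fun l : thom (sub (Bup (f b))) _ => he l (he g x)) E1).
  exact: (congr1 (fun l : thom (sub (Bup b)) H => he (merge_in pH mf) (he l x)) (esym E2)).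
Qed.

Definition merge_map b b' (m : mergable b b') (mf : mergable (f b) (f b')) :
  thom (MERGE pG m) (MERGE pH mf) := coeq_desc (merge_map_eq m mf).

Lemma merge_mapP b b' (m : mergable b b') (mf : mergable (f b) (f b'))
  (u : thom (MERGE pG m) (MERGE pH mf)) :
  thom_comp u (merge_in pG m) = thom_comp (merge_in pH mf) f <->
  u = merge_map m mf.
Proof.
split=> [h|->]; last exact: coeq_descK.
by apply: coeq_desc_uniq; rewrite coeq_descK.
Qed.

End Induced.

Record span := Span {
  lhs : tgraph G3;
  apex : tgraph G3;
  rhs : tgraph G3;
  leg1 : thom apex lhs;
  leg2 : thom apex rhs }.

Record rewrite_pattern (S : span) : Prop := RewritePattern {
  rp_lhs : pattern_graph (lhs S);
  rp_apex : pattern_graph (apex S);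
  rp_rhs : pattern_graph (rhs S);
  rp_point : point_graph (Sigma (apex S));
  rp_bound1 : set_bij (sigma_verts (apex S)) (Bound (lhs S)) (leg1 S);
  rp_bound2 : set_bij (sigma_verts (apex S)) (Bound (rhs S)) (leg2 S);
  rp_in : forall p, sigma_verts (apex S) p -> (In (lhs S) (leg1 S p) <-> In (rhs S) (leg2 S p));
  rp_out : forall p, sigma_verts (apex S) p -> (Out (lhs S) (leg1 S p) <-> Out (rhs S) (leg2 S p));
  rp_beta1 : graph_iso (beta_map (leg1 S));
  rp_beta2 : graph_iso (beta_map (leg2 S));
  rp_B1 : forall b, bangs (apex S) b -> preim (leg1 S) (B (leg1 S b)) = B b;
  rp_B2 : forall b, bangs (apex S) b -> preim (leg2 S) (B (leg2 S b)) = B b }.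

Section Operations.
Variables (S : span) (rS : rewrite_pattern S).

Definition PCOPY (b : vert (apex S)) (hb : bangs (apex S) b) : span :=
  Span (copy_map (rp_B1 rS hb)) (copy_map (rp_B2 rS hb)).

Definition PDROP (b : vert (apex S)) (hb : bangs (apex S) b) : span :=
  Span (drop_map (rp_beta1 rS) hb) (drop_map (rp_beta2 rS) hb).

Definition PKILL (b : vert (apex S)) (hb : bangs (apex S) b) : span :=
  Span (kill_map (rp_B1 rS hb)) (kill_map (rp_B2 rS hb)).

Definition PMERGE (b b' : vert (apex S)) (m : mergable b b')
    (m1 : mergable (leg1 S b) (leg1 S b'))
    (m2 : mergable (leg2 S b) (leg2 S b')) : span :=
  Span (merge_map (rp_beta1 rS) (rp_apex rS) (rp_lhs rS) m m1)
       (merge_map (rp_beta2 rS) (rp_apex rS) (rp_rhs rS) m m2).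

End Operations.

(* Main.v *)
(** Every condition in the definition of a pattern graph or of a rewrite pattern
    can be read off single edges.  In particular, since a wire has at most one
    in-edge and one out-edge in [Sigma G], the subgraph [B b] is open exactly when
    no such edge crosses its border at a wire in the forbidden direction, and a leg
    of a rewrite pattern is an injection onto the !-vertices and the boundary that
    reflects edges out of !-vertices.  DROP and KILL restrict to full subgraphs
    closed under the edges at wires; COPY and MERGE are quotients in which two
    vertices agree iff they have the same normal form (the vertex tagged by whether
    it lies in the second copy of [B b], resp. the vertex with [b] replaced by [b']),
    so each edgewise condition lifts along the quotient map. *)

From mathcomp Require Import all_boot boolp classical_sets functions.
From Stdlib Require Import Relations.
Require Import Defs.

Set Implicit Arguments.
Unset Strict Implicit.
Unset Printing Implicit Defensive.

Local Open Scope classical_set_scope.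

(** * Edgewise forms of pattern graphs, point graphs and legs *)

Section TypedGraph.
Implicit Types G H : tgraph G3.

Lemma sigma_vertsN G v : sigma_verts G v <-> ~ bangs G v.
Proof.
rewrite /sigma_verts /= /etas /omegas /bangs /=; case: (typ G v) => [[]|];
  split=> //; by [left|right|case].
Qed.

Lemma omegas_sigma G v : omegas G v -> sigma_verts G v.
Proof. by right. Qed.

Lemma omegas_nbang G v : omegas G v -> ~ bangs G v.
Proof. by move=> /omegas_sigma/sigma_vertsN. Qed.

Lemma nbang_tgt G (e : edge G) : ~ bangs G (src e) -> ~ bangs G (tgt e).
Proof. by move=> + /src_bangs. Qed.

Lemma omegas_hom G H (f : thom G H) v : omegas H (f v) <-> omegas G v.
Proof. by rewrite /omegas /= thom_typv. Qed.

Lemma sigma_hom G H (f : thom G H) v : sigma_verts H (f v) <-> sigma_verts G v.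
Proof. by rewrite !sigma_vertsN bangs_hom. Qed.

(** With [v] a !-vertex, [pd_trans] is transitivity of [beta G]; with [v] arbitrary it is the
    nesting of [B c] in [B b]. The last two fields express openness: an edge violating one of them
    would make its wire a new input or output once [B b] is deleted. *)
Record pattern_data G : Prop := PatternData {
  pd_in : forall d e : edge G, omegas G (tgt d) ->
    ~ bangs G (src d) -> ~ bangs G (src e) -> tgt d = tgt e -> d = e;
  pd_out : forall d e : edge G, omegas G (src d) -> src d = src e -> d = e;
  pd_uniq : forall d e : edge G, bangs G (tgt d) ->
    src d = src e -> tgt d = tgt e -> d = e;
  pd_refl : forall b, bangs G b -> edge_rel b b;
  pd_anti : forall v w, bangs G w -> edge_rel v w -> edge_rel w v -> v = w;
  pd_trans : forall b c v, bangs G c -> edge_rel b c -> edge_rel c v -> edge_rel b v;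
  pd_open_in : forall b (e : edge G), bangs G b -> omegas G (tgt e) ->
    ~ bangs G (src e) -> edge_rel b (src e) -> edge_rel b (tgt e);
  pd_open_out : forall b (e : edge G), bangs G b -> omegas G (src e) ->
    edge_rel b (tgt e) -> edge_rel b (src e) }.

(** An edge that does not leave a !-vertex does not enter one either, so it already lies in
    [Sigma G]. *)
Lemma string_SigmaP G : string_graph (Sigma G) <->
  (forall d e : edge G, omegas G (tgt d) ->
    ~ bangs G (src d) -> ~ bangs G (src e) -> tgt d = tgt e -> d = e) /\
  (forall d e : edge G, omegas G (src d) -> src d = src e -> d = e).
Proof.
split=> [sG|[si so]].
- split=> d e hd.
  + move=> nd ne E.
    have Pd : se (full (sigma_verts G)) d.
      by split; apply/sigma_vertsN => //; exact: nbang_tgt.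
    have Pe : se (full (sigma_verts G)) e.
      by split; apply/sigma_vertsN => //; exact: nbang_tgt.
    have T : typ (Sigma G) (@tgt (Sigma G) (exist _ d Pd)) = Wire by rewrite /= hd.
    have [+ _] := sG _ T => /(_ (exist _ d Pd) (exist _ e Pe) erefl) h.
    suff : exist _ d Pd = exist _ e Pe :> edge (Sigma G) by move/(congr1 sval).
    by apply: h; apply: eq_exist.
  + move=> E; have nd := omegas_nbang hd; have ne := nd; rewrite E in ne.
    have Pd : se (full (sigma_verts G)) d.
      by split; apply/sigma_vertsN => //; exact: nbang_tgt.
    have Pe : se (full (sigma_verts G)) e.
      by split; apply/sigma_vertsN => //; exact: nbang_tgt.
    have T : typ (Sigma G) (@src (Sigma G) (exist _ d Pd)) = Wire by rewrite /= hd.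
    have [_ +] := sG _ T => /(_ (exist _ d Pd) (exist _ e Pe) erefl) h.
    suff : exist _ d Pd = exist _ e Pe :> edge (Sigma G) by move/(congr1 sval).
    by apply: h; apply: eq_exist.
- move=> [v sv_v] /= hv.
  have {}hv : omegas G v by move/sigma_vertsP: sv_v; rewrite /omegas /= hv.
  split=> -[d [ds dt]] [e [es et]] [ed] [ee]; apply: eq_exist.
  + apply: si; [by rewrite ed|by apply/sigma_vertsN|by apply/sigma_vertsN|].
    by rewrite ed ee.
  + by apply: so; rewrite ed ?ee.
Qed.

(** Only the last vertex of a path has to be assumed a !-vertex, since predecessors of !-vertices
    are !-vertices. *)
Lemma posetal_betaP G : posetal (beta G) <->
  [/\ forall d e : edge G, bangs G (tgt d) ->
        src d = src e -> tgt d = tgt e -> d = e,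
      forall b, bangs G b -> edge_rel b b,
      forall v w, bangs G w -> edge_rel v w -> edge_rel w v -> v = w
    & forall b c d, bangs G d -> edge_rel b c -> edge_rel c d -> edge_rel b d].
Proof.
split=> [[uE rE aE tE]|[uE rE aE tE]]; split.
- move=> d e bt es et.
  have Pd : se (full (bangs G)) d by split=> //=; apply: src_bangs.
  have Pe : se (full (bangs G)) e by split=> /=; rewrite -?es -?et //; apply: src_bangs.
  suff : exist _ d Pd = exist _ e Pe :> edge (beta G) by move/(congr1 sval).
  by apply: uE; apply: eq_exist.
- by move=> b hb; have /beta_edge_rel := rE (exist _ b hb).
- move=> v w hw vw wv; have hv := preds_bangs hw vw.
  suff : exist _ v hv = exist _ w hw :> vert (beta G) by move/(congr1 sval).
  by apply: aE; apply/beta_edge_rel.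
- move=> b c d hd bc cd; have hc := preds_bangs hd cd; have hb := preds_bangs hc bc.
  have /beta_edge_rel // : @edge_rel (beta G) (exist _ b hb) (exist _ d hd).
  by apply: (tE _ (exist _ c hc)); apply/beta_edge_rel.
- move=> [d [ds dt]] [e [es et]] /(congr1 sval)/= E1 /(congr1 sval)/= E2.
  by apply: eq_exist; apply: uE.
- by move=> [v hv]; apply/beta_edge_rel; apply: rE.
- move=> [v hv] [w hw] /beta_edge_rel vw /beta_edge_rel wv.
  by apply: eq_exist; apply: aE.
- move=> [u hu] [v hv] [w hw] /beta_edge_rel uv /beta_edge_rel vw.
  by apply/beta_edge_rel; apply: (tE _ v).
Qed.

(* The in- and out-edge of a wire are unique, so openness of [B b] only says
   that these edges do not leave [B b] on the wrong side. *)
Lemma open_BP G b : string_graph (Sigma G) -> open_subgraph (@B G b) <->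
  (forall e : edge G, omegas G (tgt e) -> ~ bangs G (src e) ->
     edge_rel b (src e) -> edge_rel b (tgt e)) /\
  (forall e : edge G, omegas G (src e) -> edge_rel b (tgt e) -> edge_rel b (src e)).
Proof.
move=> /string_SigmaP[si so]; split=> [[oi oo]|[oi oo]]; split.
- move=> e ht ns bs; apply: contrapT => nbt.
  have Pt : sv (minus (B b)) (tgt e) by [].
  suff : In G (tgt e) by move=> [_ /(_ e erefl)].
  apply: oi; exists (exist _ (tgt e) Pt) => //; split=> //.
  move=> [d pd] /(congr1 sval)/= E; have [_ /= Ds Dt] := pd; apply: contrapT => nd.
  by have de : d = e by [apply: si; rewrite ?E]; subst d.
- move=> e hs bt; apply: contrapT => nbs.
  have Ps : sv (minus (B b)) (src e) by [].
  suff : Out G (src e) by move=> [_ /(_ e erefl)].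
  apply: oo; exists (exist _ (src e) Ps) => //; split=> //.
  move=> [d pd] /(congr1 sval)/= E; have [_ /= Ds Dt] := pd.
  by have de : d = e by [apply: so; rewrite ?E]; subst d.
- move=> _ [[v pv] [hv iv] <-] /=; have [_ /= nv] := pv; split=> // e E; apply: contrapT => ns.
  have Pe : se (minus (B b)) e.
    by split=> //= [bs|]; rewrite ?E //; apply: nv; rewrite -E; apply: oi => //; rewrite E.
  by apply: ns; apply: (iv (exist _ e Pe)); apply: eq_exist.
- move=> _ [[v pv] [hv ov] <-] /=; have [_ /= nv] := pv; split=> // e E.
  have Pe : se (minus (B b)) e.
    by split=> //= [|bt]; rewrite ?E //; apply: nv; rewrite -E; apply: oo => //; rewrite E.
  by apply: (ov (exist _ e Pe)); apply: eq_exist.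
Qed.

Lemma B_leP G (b c : vert G) : subgraph_le (B c) (B b) <->
  (forall v, edge_rel c v -> edge_rel b v).
Proof.
split=> [[h _] v|h]; first exact: h.
by split=> [v|e [cs ct]]; [exact: h|split; exact: h].
Qed.

Lemma pattern_graphP G : pattern_graph G <-> pattern_data G.
Proof.
split=> [[sG /posetal_betaP[uE rE aE _] oG tG]|[si so uE rE aE tE oi oo]].
- have [si so] := (string_SigmaP G).1 sG; split=> //.
  + move=> b c v hc bc; apply: (B_leP b c).1; apply: tG => //.
    exact: preds_bangs hc bc.
  + by move=> b e hb; apply: ((open_BP b sG).1 (oG _ hb)).1.
  + by move=> b e hb; apply: ((open_BP b sG).1 (oG _ hb)).2.
- have sG : string_graph (Sigma G) by apply/string_SigmaP.
  split=> //.
  + apply/posetal_betaP; split=> // b c d hd bc cd.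
    by apply: (tE _ c) => //; apply: preds_bangs hd cd.
  + by move=> b hb; apply/(open_BP b sG); split=> e; [exact: oi|exact: oo].
  + by move=> b c hb hc bc; apply/B_leP => v; apply: tE.
Qed.

(** The second clause says that [Sigma G] has no edges, which makes all its vertices isolated and
    the string condition vacuous. *)
Lemma point_SigmaP G : point_graph (Sigma G) <->
  (forall v, sigma_verts G v -> omegas G v) /\ (forall e : edge G, bangs G (src e)).
Proof.
split=> [[_ pG]|[hv he]]; last first.
  have ne (e : edge (Sigma G)) : False.
    by case: e => e [/= /sigma_vertsN h _]; apply: h; apply: he.
  split=> [v _|[v sv_v]]; first by split=> d; case: (ne d).
  by split=> [|d|d]; [rewrite /= (hv _ sv_v)|case: (ne d)|case: (ne d)].
split=> [v hv|e].
  have [/= T _ _] := pG (exist _ v hv).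
  by move/sigma_vertsP: hv; rewrite T.
apply: contrapT => ns.
have Ps : sigma_verts G (src e) by apply/sigma_vertsN.
have Pt : sigma_verts G (tgt e) by apply/sigma_vertsN; exact: nbang_tgt.
have [_ _ /(_ (exist _ e (conj Ps Pt)))] := pG (exist _ (src e) Ps).
by apply; apply: eq_exist.
Qed.

(** Injectivity can be asked globally because [f] preserves types, so a !-vertex never collides with
    another kind of vertex. [ld_refl] serves twice: it is the condition on preimages of boxes, and
    between !-vertices it lifts the edges of [beta H]. *)
Record leg_data G H (f : thom G H) : Prop := LegData {
  ld_inj : injective f;
  ld_bang : forall w, bangs H w -> exists v, f v = w;
  ld_bound : forall w, Bound H w -> exists v, f v = w;
  ld_sigma : forall v, sigma_verts G v -> Bound H (f v);
  ld_refl : forall b v, bangs G b -> edge_rel (f b) (f v) -> edge_rel b v }.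

Lemma Bound_omegas G v : Bound G v -> omegas G v.
Proof. by case=> -[]. Qed.

(** One inclusion holds for every morphism, and the edges follow the vertices because boxes are full
    subgraphs. *)
Lemma preim_BP G H (f : thom G H) b : preim f (B (f b)) = B b <->
  (forall v, edge_rel (f b) (f v) -> edge_rel b v).
Proof.
split=> [E v h|h].
  by have : sv (B b) v by rewrite -E.
have E v : edge_rel (f b) (f v) <-> edge_rel b v by split=> [/h|/(@preds_hom _ _ f v b)].
apply: subgraph_eq; apply/predeqP => x; first exact: E.
by rewrite /= hom_src hom_tgt; split=> -[/E ? /E].
Qed.

Lemma legP G H (f : thom G H) : pattern_data G -> pattern_data H ->
  [/\ set_bij (sigma_verts G) (Bound H) f, graph_iso (beta_map f)
    & forall b, bangs G b -> preim f (B (f b)) = B b] <-> leg_data f.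
Proof.
move=> pG pH; split=> [[[bh bi bs] isof fB]|[fi fb fs sB fr]].
- have [g [K1 K2 _ _]] := isof; split.
  + move=> v w E; have [hv|/sigma_vertsN hv] := pselect (bangs G v).
      by apply: (beta_iso_inj isof) => //; apply/(bangs_hom f); rewrite -E; apply/bangs_hom.
    have hw : sigma_verts G w by apply/(sigma_hom f); rewrite -E; apply/sigma_hom.
    by apply: bi; rewrite ?inE.
  + move=> w hw; exists (sval (g (exist _ w hw))).
    exact: (congr1 sval (K2 (exist _ w hw))).
  + by move=> w /bs[v _ <-]; exists v.
  + exact: bh.
  + by move=> b v hb; move/preim_BP: (fB b hb); apply.
- split; last by move=> b hb; apply/preim_BP => v; apply: fr.
  + split=> [v|v w _ _|w hw]; [exact: sB|exact: fi|].
    have [v E] := fs _ hw; exists v => //; apply/(sigma_hom f).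
    by rewrite E; apply: omegas_sigma; apply: Bound_omegas.
  + have gv (w : vert (beta H)) : exists v : vert (beta G), beta_map f v = w.
      case: w => w hw; have [v E] := fb w hw.
      have hv : bangs G v by apply/(bangs_hom f); rewrite E.
      by exists (exist _ v hv); apply: eq_exist.
    have ge (e : edge (beta H)) : exists d : edge (beta G), he (beta_map f) d = e.
      case: e => e [es et]; have [v vE] := fb _ es; have [w wE] := fb _ et.
      have hv : bangs G v by apply/(bangs_hom f); rewrite vE.
      have hw : bangs G w by apply/(bangs_hom f); rewrite wE.
      (* The lifted edge maps to an edge parallel to [e], hence to [e] itself, as [H] has no
         parallel edges between !-vertices. *)
      have [d [ds dt]] : edge_rel v w by apply: fr; rewrite ?vE ?wE //; exists e.
      have Pd : se (full (bangs G)) d by split; rewrite /= ?ds ?dt.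
      exists (exist _ d Pd); apply: eq_exist => /=; apply: (pd_uniq pH).
      * by rewrite hom_tgt dt; apply/bangs_hom.
      * by rewrite hom_src ds vE.
      * by rewrite hom_tgt dt wE.
    (* The inverse chooses preimages; injectivity of [beta_map f] then makes this choice a graph
       morphism and a two-sided inverse. *)
    pose gV w := sval (cid (gv w)); pose gE e := sval (cid (ge e)).
    have gVK w : beta_map f (gV w) = w by exact: (svalP (cid (gv w))).
    have gEK e : he (beta_map f) (gE e) = e by exact: (svalP (cid (ge e))).
    have iV : injective (beta_map f).
      by move=> v w /(congr1 sval)/= /fi /sval_inj.
    have iE : injective (he (beta_map f)).
      move=> d e E; apply: sval_inj; apply: (pd_uniq pG).
      - by case: (svalP d).
      - by apply: fi; rewrite -!hom_src; move/(congr1 sval): E => /= ->.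
      - by apply: fi; rewrite -!hom_tgt; move/(congr1 sval): E => /= ->.
    unshelve eexists (@Hom (beta H) (beta G) gV gE _ _) => [e|e|].
    * by apply: iV; rewrite gVK -hom_src gEK.
    * by apply: iV; rewrite gVK -hom_tgt gEK.
    * split=> x; [exact: (iV _ _ (gVK _))|exact: gVK|exact: (iE _ _ (gEK _))|exact: gEK].
Qed.

(** Edges of [G] map forward, so any morphism reflects inputs; the converse needs every in-edge of
    [f v] from outside the !-vertices to be witnessed by one at [v]. *)
Lemma In_lift G H (f : thom G H) v :
  (forall e : edge H, omegas G v -> tgt e = f v -> ~ bangs H (src e) ->
     exists2 d : edge G, tgt d = v & ~ bangs G (src d)) ->
  In H (f v) <-> In G v.
Proof.
move=> h; split=> -[hv iv]; split=> //; try exact/(omegas_hom f).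
- by move=> e E; apply/(bangs_hom f); rewrite -hom_src; apply: iv; rewrite hom_tgt E.
- move=> e E; apply: contrapT => ns.
  by have [d dt] := h e hv E ns; apply; apply: iv.
Qed.

Lemma Out_lift G H (f : thom G H) v :
  (forall e : edge H, omegas G v -> src e = f v -> exists d : edge G, src d = v) ->
  Out H (f v) <-> Out G v.
Proof.
move=> h; split=> -[hv iv]; split; try by apply/(omegas_hom f).
- by move=> e E; apply: (iv (he f e)); rewrite hom_src E.
- by move=> e /(h e hv)[d]; apply: iv.
Qed.

End TypedGraph.

(** * Rewrite patterns in edgewise form *)

Section RewritePattern.
Variable S : span.

Lemma rewrite_patternP : rewrite_pattern S <->
  [/\ [/\ pattern_data (lhs S), pattern_data (apex S) & pattern_data (rhs S)],
      point_graph (Sigma (apex S)),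
      leg_data (leg1 S), leg_data (leg2 S)
    & forall p, sigma_verts (apex S) p ->
        (In (lhs S) (leg1 S p) <-> In (rhs S) (leg2 S p)) /\
        (Out (lhs S) (leg1 S p) <-> Out (rhs S) (leg2 S p))].
Proof.
split=> [[/pattern_graphP pL /pattern_graphP pI /pattern_graphP pR
          pt b1 b2 hi ho i1 i2 B1 B2]|[[pL pI pR] pt l1 l2 h]].
  split=> //; [by apply/legP|by apply/legP|].
  by move=> p hp; split; [exact: hi|exact: ho].
have [b1 i1 B1] := (legP _ pI pL).2 l1; have [b2 i2 B2] := (legP _ pI pR).2 l2.
split=> //; [exact/pattern_graphP|exact/pattern_graphP|exact/pattern_graphP| |].
- by move=> p /h[].
- by move=> p /h[].
Qed.

End RewritePattern.

(** * Restriction of pattern graphs and legs to induced subgraphs *)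

Section InducedSubgraph.
Implicit Types G H : tgraph G3.

Definition induced (G : graph) (K : subgraph G) : Prop :=
  forall e, sv K (src e) -> sv K (tgt e) -> se K e.

Lemma induced_minus (G : graph) (K : subgraph G) : induced (minus K).
Proof. by move=> e [_ ns] [_ nt]. Qed.

Lemma induced_minusv (G : graph) (b : vert G) : induced (minusv b).
Proof. by move=> e [_ ns] [_ nt]. Qed.

Lemma sub_edge_rel G (K : subgraph G) (v w : vert (@sub G3 G K)) : induced K ->
  edge_rel v w <-> edge_rel (sval v) (sval w).
Proof.
move=> iK; split=> [[e [<- <-]]|[e [ev ew]]]; first by exists (sval e).
have Pe : se K e by apply: iK; rewrite ?ev ?ew; apply: svalP.
exists (exist _ e Pe : edge (@sub G3 G K)).
by split; apply: sval_inj.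
Qed.

(** Each clause concerns given vertices and the edges between them, and an induced subgraph keeps
    all of these edges. *)
Lemma sub_pattern G (K : subgraph G) : induced K -> pattern_data G ->
  pattern_data (@sub G3 G K).
Proof.
move=> iK [si so uE rE aE tE oi oo]; split.
- by move=> d e hd nd ne /(congr1 sval) E; apply: sval_inj; apply: si.
- by move=> d e hd /(congr1 sval) E; apply: sval_inj; apply: so.
- move=> d e hd /(congr1 sval) E1 /(congr1 sval) E2.
  by apply: sval_inj; apply: uE.
- by move=> b hb; apply/(sub_edge_rel _ _ iK); apply: rE.
- move=> v w hw /(sub_edge_rel _ _ iK) vw /(sub_edge_rel _ _ iK) wv.
  by apply: sval_inj; apply: aE.
- move=> b c v hc /(sub_edge_rel _ _ iK) bc /(sub_edge_rel _ _ iK) cv.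
  by apply/(sub_edge_rel _ _ iK); apply: tE cv.
- move=> b e hb ht ns /(sub_edge_rel _ _ iK) bs.
  by apply/(sub_edge_rel _ _ iK); apply: oi.
- move=> b e hb hs /(sub_edge_rel _ _ iK) bt.
  by apply/(sub_edge_rel _ _ iK); apply: oo.
Qed.

(** Ensures that restricting to [K] turns no kept wire into a new input or output. *)
Definition wire_closed G (K : subgraph G) : Prop :=
  (forall e : edge G, omegas G (tgt e) -> ~ bangs G (src e) ->
     sv K (tgt e) -> sv K (src e)) /\
  (forall e : edge G, omegas G (src e) -> sv K (src e) -> sv K (tgt e)).

(** The deleted vertex is a !-vertex, whereas the neighbours in question are not. *)
Lemma wire_closed_minusv G b : bangs G b -> wire_closed (minusv b).
Proof.
move=> hb; split=> e.
- by move=> ht ns _; split=> // E; apply: ns; rewrite E.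
- move=> /omegas_nbang hs _; split=> // E; apply: (nbang_tgt hs).
  by rewrite E.
Qed.

Lemma wire_closed_minusB G b : pattern_data G -> bangs G b ->
  wire_closed (minus (@B G b)).
Proof.
move=> pG hb; split=> e.
- by move=> ht ns [_ nt]; split=> // bs; apply: nt; apply: (pd_open_in pG).
- by move=> hs [_ ns]; split=> // bt; apply: ns; apply: (pd_open_out pG).
Qed.

Lemma In_sub G (K : subgraph G) (v : vert (@sub G3 G K)) :
  induced K -> wire_closed K ->
  In (@sub G3 G K) v <-> In G (sval v).
Proof.
move=> iK [ci _]; apply: iff_sym; apply: (@In_lift _ _ (sub_incl K)) => e /= hv E ns.
have Pt : sv K (tgt e) by rewrite E; apply: svalP.
have Ps : sv K (src e) by apply: ci => //; rewrite E.
by exists (exist _ e (iK _ Ps Pt)) => //; apply: sval_inj.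
Qed.

Lemma Out_sub G (K : subgraph G) (v : vert (@sub G3 G K)) :
  induced K -> wire_closed K ->
  Out (@sub G3 G K) v <-> Out G (sval v).
Proof.
move=> iK [_ co]; apply: iff_sym; apply: (@Out_lift _ _ (sub_incl K)) => e /= hv E.
have Ps : sv K (src e) by rewrite E; apply: svalP.
have Pt : sv K (tgt e) by apply: co => //; rewrite E.
by exists (exist _ e (iK _ Ps Pt)) => //; apply: sval_inj.
Qed.

Lemma point_sub G (K : subgraph G) :
  point_graph (Sigma G) -> point_graph (Sigma (@sub G3 G K)).
Proof.
move=> /point_SigmaP[pv pe]; apply/point_SigmaP; split=> [v hv|e].
- exact: (pv (sval v) hv).
- exact: (pe (sval e)).
Qed.

(** The vertices of [K] are the full preimage of those of [K'], so preimages under [f] stay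
    available; [wire_closed K'] makes the boundary of the restriction the part of the boundary of
    [H] inside [K']. *)
Lemma leg_restr G H (f : thom G H) (K : subgraph G) (K' : subgraph H)
    (fK : subgraph_le K (preim f K')) :
  (forall v, sv K' (f v) -> sv K v) -> induced K -> induced K' ->
  wire_closed K' -> leg_data f -> leg_data (restr fK).
Proof.
move=> rK iK iK' cK' [fi fb fs sB fr].
have Bsub (w : vert (@sub G3 H K')) : Bound (@sub G3 H K') w <-> Bound H (sval w).
  by rewrite /Bound /setU /= In_sub // Out_sub.
split.
- by move=> v w /(congr1 sval)/= /fi /sval_inj.
- move=> [w pw] /= hw; have [v E] := fb w hw.
  have Pv : sv K v by apply: rK; rewrite E.
  by exists (exist _ v Pv); apply: eq_exist.
- move=> w /Bsub/fs[v E].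
  have Pv : sv K v by apply: rK; rewrite E; apply: svalP.
  by exists (exist _ v Pv); apply: sval_inj.
- by move=> v /(sB (sval v)) h; apply/Bsub.
- move=> b v hb /(sub_edge_rel _ _ iK') h; apply/(sub_edge_rel _ _ iK).
  exact: fr.
Qed.

End InducedSubgraph.

(** * The operations DROP and KILL *)

Section Drop_Kill.
Variables (S : span) (rS : rewrite_pattern S).
Variables (b : vert (apex S)) (hb : bangs (apex S) b).

Lemma PDROP_rewrite_pattern : rewrite_pattern (PDROP rS hb).
Proof.
have hb1 := (bangs_hom (leg1 S) b).2 hb; have hb2 := (bangs_hom (leg2 S) b).2 hb.
have [[pL pI pR] pt l1 l2 io] := (rewrite_patternP S).1 rS.
have c1 := wire_closed_minusv hb1; have c2 := wire_closed_minusv hb2.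
have i0 := @induced_minusv (apex S) b.
have i1 := @induced_minusv (lhs S) (leg1 S b); have i2 := @induced_minusv (rhs S) (leg2 S b).
apply/rewrite_patternP; split.
- by split; exact: sub_pattern.
- exact: point_sub.
- by apply: leg_restr => // v [_ n]; split=> // E; apply: n; rewrite E.
- by apply: leg_restr => // v [_ n]; split=> // E; apply: n; rewrite E.
- move=> [p pp] hp; have [hi ho] := io p hp.
  by rewrite !In_sub // !Out_sub.
Qed.

Lemma PKILL_rewrite_pattern : rewrite_pattern (PKILL rS hb).
Proof.
have hb1 := (bangs_hom (leg1 S) b).2 hb; have hb2 := (bangs_hom (leg2 S) b).2 hb.
have [[pL pI pR] pt l1 l2 io] := (rewrite_patternP S).1 rS.
have c1 := wire_closed_minusB pL hb1; have c2 := wire_closed_minusB pR hb2.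
have i0 := @induced_minus (apex S) (B b).
have i1 := @induced_minus (lhs S) (B (leg1 S b)).
have i2 := @induced_minus (rhs S) (B (leg2 S b)).
apply/rewrite_patternP; split.
- by split; exact: sub_pattern.
- exact: point_sub.
- by apply: leg_restr => // v [_ n]; split=> // bv; apply: n; apply: (@preds_hom _ _ (leg1 S) v b).
- by apply: leg_restr => // v [_ n]; split=> // bv; apply: n; apply: (@preds_hom _ _ (leg2 S) v b).
- move=> [p pp] hp; have [hi ho] := io p hp.
  by rewrite !In_sub // !Out_sub.
Qed.

End Drop_Kill.

(** * The operation COPY: tagged vertices and edges *)

Section Copy.
Variables (G : tgraph G3) (b : vert G).

(** A boolean tag indexes the two coprojections, so that both copies are handled by one argument. *)
Definition copy_in (k : bool) : thom G (COPY b) :=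
  if k then copy_in2 b else copy_in1 b.

Lemma copy_surjv x : exists k v, x = copy_in k v.
Proof.
by rewrite -(quot_repK x); case: (quot_rep x) => v; [exists false|exists true]; exists v.
Qed.

Lemma copy_surje d : exists k e, d = he (copy_in k) e.
Proof.
by rewrite -(quot_repK d); case: (quot_rep d) => e; [exists false|exists true]; exists e.
Qed.

(* Each generating identification preserves the underlying element, and relates
   only elements of the shared part [G \ B b]. *)
Lemma copy_in_vE j k v w :
  copy_in j v = copy_in k w <-> v = w /\ (sv (B b) v -> j = k).
Proof.
split; last first.
  move=> [<-]; case: (pselect (sv (B b) v)) => [bv /(_ bv) -> //|nv _].
  have := pushout_eq (sub_incl (minus (B b))) (sub_incl (minus (B b))).
  have Pv : sv (minus (B b)) v by [].
  move/(congr1 (fun l : thom (sub (minus (B b))) _ => l (exist _ v Pv))) => /= E.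
  by case: j; case: k => //; symmetry.
pose nf (x : vert G + vert G) := match x with
  | inl v => (v, False) | inr v => (v, sv (B b) v) end.
have nfE x y : clos_refl_sym_trans _ (coeq_relv
    (pushout_legl G (sub_incl (minus (B b))))
    (pushout_legr G (sub_incl (minus (B b))))) x y ->
    nf x = nf y.
  elim=> [_ _ [[a [_ /= na]] [<- <-]]|//|? ? _ ->|? ? ? _ -> _ ->] //=.
  by congr pair; apply/propext.
by case: j; case: k => /quot_inE/nfE/= [-> //] E; split=> // h; exfalso;
  move: h; rewrite ?E // -E.
Qed.

Lemma copy_in_eE j k d e :
  he (copy_in j) d = he (copy_in k) e <-> d = e /\ (~ se (minus (B b)) d -> j = k).
Proof.
split; last first.
  move=> [<-]; case: (pselect (se (minus (B b)) d)) => [Pd _|nd /(_ nd) -> //].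
  have := pushout_eq (sub_incl (minus (B b))) (sub_incl (minus (B b))).
  move/(congr1 (fun l : thom (sub (minus (B b))) _ => he l (exist _ d Pd))) => /= E.
  by case: j; case: k => //; symmetry.
(* The tag survives in the normal form only for a second-copy edge that touches [B b]; shared edges
   get the same tag from either side. *)
pose nf (x : edge G + edge G) := match x with
  | inl v => (v, False) | inr v => (v, ~ se (minus (B b)) v) end.
have nfE x y : clos_refl_sym_trans _ (coeq_rele
    (pushout_legl G (sub_incl (minus (B b))))
    (pushout_legr G (sub_incl (minus (B b))))) x y ->
    nf x = nf y.
  elim=> [_ _ [[a na] [<- <-]]|//|? ? _ ->|? ? ? _ -> _ ->] //=.
  by congr pair; apply/propext; split=> // /(_ na).
by case: j; case: k => /quot_inE/nfE/= [-> //] E; split=> // h; exfalso;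
  move: h; rewrite ?E // -E.
Qed.

(** An edge of the pushout lives in a single copy, but an endpoint outside [B b] is shared and may
    carry either tag. *)
Lemma copy_edge j k v w : edge_rel (copy_in j v) (copy_in k w) <->
  edge_rel v w /\ (sv (B b) v -> sv (B b) w -> j = k).
Proof.
split=> [[d [ds dt]]|[[e [<- <-]] h]].
  have [i [e E]] := copy_surje d; move: ds dt.
  rewrite {}E hom_src hom_tgt => /copy_in_vE[<- h1] /copy_in_vE[<- h2].
  by split=> [|/h1 <- /h2]; first by exists e.
(* If the source is in [B b], its tag decides the copy; otherwise the source is shared and the tag
   of the target is taken. *)
case: (pselect (sv (B b) (src e))) => [bs|ns].
- exists (he (copy_in j) e); rewrite hom_src hom_tgt; split=> //.
  by apply/copy_in_vE; split=> // /(h bs).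
- exists (he (copy_in k) e); rewrite hom_src hom_tgt; split=> //.
  by apply/copy_in_vE.
Qed.

Hypothesis pG : pattern_data G.

Lemma copy_pattern : bangs G b -> pattern_data (COPY b).
Proof.
move=> hb; have [si so uE rE aE tE oi oo] := pG.
split.
- move=> d e; have [j [d' ->]] := copy_surje d; have [k [e' ->]] := copy_surje e.
  rewrite !hom_src !hom_tgt !omegas_hom !bangs_hom => hd nd ne /copy_in_vE[E jk].
  have de : d' = e' by apply: si.
  (* By openness, an edge into a wire that touches [B b] touches it at that wire, where the tags are
     known to agree. *)
  subst e'; apply/copy_in_eE; split=> // nB; apply: jk; apply: contrapT => nt.
  by apply: nB; split=> // bs; apply: nt; apply: oi.
- move=> d e; have [j [d' ->]] := copy_surje d; have [k [e' ->]] := copy_surje e.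
  rewrite !hom_src !omegas_hom => hd /copy_in_vE[E jk].
  have de : d' = e' by apply: so.
  subst e'; apply/copy_in_eE; split=> // nB; apply: jk; apply: contrapT => ns.
  by apply: nB; split=> // bt; apply: ns; apply: oo.
- move=> d e; have [j [d' ->]] := copy_surje d; have [k [e' ->]] := copy_surje e.
  rewrite !hom_src !hom_tgt !bangs_hom => hd /copy_in_vE[E1 jk1] /copy_in_vE[E2 jk2].
  have de : d' = e' by apply: uE.
  subst e'; apply/copy_in_eE; split=> // nB.
  case: (pselect (sv (B b) (src d'))) => [/jk1 //|ns].
  by apply: jk2; apply: contrapT => nt; apply: nB; split.
- move=> x; have [j [v ->]] := copy_surjv x; rewrite bangs_hom => hv.
  by apply/copy_edge; split; [exact: rE|].
- move=> x y; have [j [v ->]] := copy_surjv x; have [k [w ->]] := copy_surjv y.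
  rewrite bangs_hom => hw /copy_edge[vw h] /copy_edge[wv _].
  have E : v = w by apply: aE.
  by subst w; apply/copy_in_vE; split=> // bv; apply: h.
- move=> x y z; have [i [u ->]] := copy_surjv x; have [j [v ->]] := copy_surjv y.
  have [k [w ->]] := copy_surjv z.
  rewrite bangs_hom => hv /copy_edge[uv h1] /copy_edge[vw h2].
  apply/copy_edge; split=> [|bu bw]; first exact: tE vw.
  (* A box whose !-vertex is in [B b] lies inside [B b], so the middle vertex carries a tag and
     links those of the ends. *)
  have bv : sv (B b) v by apply: (tE b u) => //; exact: preds_bangs hv uv.
  by rewrite h1 // h2.
- move=> x e; have [i [c ->]] := copy_surjv x; have [j [e' ->]] := copy_surje e.
  rewrite !hom_src !hom_tgt !omegas_hom !bangs_hom => hc ht ns /copy_edge[cs h].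
  apply/copy_edge; split=> [|bc _]; first exact: oi.
  by apply: h => //; apply: (tE b c).
- move=> x e; have [i [c ->]] := copy_surjv x; have [j [e' ->]] := copy_surje e.
  rewrite !hom_src !hom_tgt !omegas_hom !bangs_hom => hc hs /copy_edge[ct h].
  apply/copy_edge; split=> [|bc _]; first exact: oo.
  by apply: h => //; apply: (tE b c).
Qed.

Lemma In_copy k v : In (COPY b) (copy_in k v) <-> In G v.
Proof.
apply: In_lift => e _; have [j [d ->]] := copy_surje e.
rewrite hom_src hom_tgt bangs_hom => /copy_in_vE[<- _] ns.
by exists d.
Qed.

Lemma Out_copy k v : Out (COPY b) (copy_in k v) <-> Out G v.
Proof.
apply: Out_lift => e _; have [j [d ->]] := copy_surje e.
by rewrite hom_src => /copy_in_vE[<- _]; exists d.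
Qed.

Lemma Bound_copy k v : Bound (COPY b) (copy_in k v) <-> Bound G v.
Proof. by rewrite /Bound /setU /= In_copy Out_copy. Qed.

Lemma point_copy : point_graph (Sigma G) -> point_graph (Sigma (COPY b)).
Proof.
move=> /point_SigmaP[pv pe]; apply/point_SigmaP; split=> [x|d].
- have [k [v ->]] := copy_surjv x; rewrite sigma_hom omegas_hom; exact: pv.
- by have [k [e ->]] := copy_surje d; rewrite hom_src bangs_hom; exact: pe.
Qed.

End Copy.

(** * Legs under COPY *)

Section CopyLeg.
Variables (G H : tgraph G3) (f : thom G H) (b : vert G) (E : preserves_B f b).

Lemma copy_map_in k v : copy_map E (copy_in b k v) = copy_in (f b) k (f v).
Proof.
have [E1 E2] := (copy_mapP E (copy_map E)).2 erefl.
by case: k; [move: E2|move: E1] => /(congr1 (fun l : thom G _ => l v)).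
Qed.

(** The induced map keeps tags, and [f] preserves and reflects membership in the copied box, so each
    clause reduces to the one for [f]. *)
Lemma leg_copy : leg_data f -> leg_data (copy_map E).
Proof.
move=> [fi fb fs sB fr].
have fB v : sv (B (f b)) (f v) <-> sv (B b) v.
  by split; [move/preim_BP: E; apply|exact: (@preds_hom _ _ f v b)].
split.
- move=> x y; have [j [v ->]] := copy_surjv x; have [k [w ->]] := copy_surjv y.
  rewrite !copy_map_in => /copy_in_vE[/fi <- h].
  by apply/copy_in_vE; split=> // /fB.
- move=> y; have [k [w ->]] := copy_surjv y; rewrite bangs_hom => /fb[v <-].
  by exists (copy_in b k v); rewrite copy_map_in.
- move=> y; have [k [w ->]] := copy_surjv y; move=> /Bound_copy/fs[v <-].
  by exists (copy_in b k v); rewrite copy_map_in.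
- move=> x; have [k [v ->]] := copy_surjv x; rewrite sigma_hom => /sB hv.
  by rewrite copy_map_in; apply/Bound_copy.
- move=> x y; have [j [c ->]] := copy_surjv x; have [k [v ->]] := copy_surjv y.
  rewrite bangs_hom !copy_map_in => hc /copy_edge[cv h].
  apply/copy_edge; split=> [|/fB bc /fB bv]; first exact: fr.
  exact: h.
Qed.

End CopyLeg.

Lemma PCOPY_rewrite_pattern (S : span) (rS : rewrite_pattern S)
  (b : vert (apex S)) (hb : bangs (apex S) b) : rewrite_pattern (PCOPY rS hb).
Proof.
have hb1 := (bangs_hom (leg1 S) b).2 hb; have hb2 := (bangs_hom (leg2 S) b).2 hb.
have [[pL pI pR] pt l1 l2 io] := (rewrite_patternP S).1 rS.
apply/rewrite_patternP; split.
- by split; exact: copy_pattern.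
- exact: point_copy.
- exact: leg_copy.
- exact: leg_copy.
- move=> p; have [k [v ->]] := copy_surjv p.
  cbn [apex lhs rhs leg1 leg2 PCOPY]; rewrite sigma_hom !copy_map_in.
  by move=> /io; rewrite !In_copy !Out_copy.
Qed.

(** * The operation MERGE: the quotient identifying [b] with [b'] *)

Section Merge.
Variables (G : tgraph G3) (pG : pattern_graph G) (b b' : vert G) (m : mergable b b').

Let qG : thom G (MERGE pG m) := merge_in pG m.

Lemma swap_eq v w : swap b b' v = swap b b' w ->
  [\/ v = w, v = b /\ w = b' | v = b' /\ w = b].
Proof.
case: (pselect (v = b)) => [->|nv]; case: (pselect (w = b)) => [->|nw].
- by move=> _; constructor 1.
- by rewrite swapE swapN // => <-; constructor 2.
- by rewrite swapE swapN // => ->; constructor 3.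
- by rewrite !swapN // => ->; constructor 1.
Qed.

(** [swap b b'] is a collapse and not a transposition: it fixes [b'], which makes it a normal form
    for the vertices of the quotient. *)
Lemma swap_id v : swap b b' (swap b b' v) = swap b b' v.
Proof.
case: (pselect (v = b)) => [->|nv]; last by rewrite !swapN.
by rewrite swapE; case: (pselect (b' = b)) => [->|?]; [rewrite swapE|rewrite swapN].
Qed.

Lemma Bup_isoE v : sval (Bup_iso pG m v) = swap b b' (sval v).
Proof.
have [_ i1 i2 _] := Bup_isoP pG m; case: (pselect (sval v = b)) => E.
- by rewrite i1 // E swapE.
- by rewrite i2 // swapN.
Qed.

Lemma mergable_disjoint v : edge_rel b v -> ~ edge_rel b' v.
Proof.
have [_ _ _ D] := m => bv bv'.
by have : (sv (B b) `&` sv (B b')) v by []; rewrite D.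
Qed.

Lemma merge_surjv x : exists v, x = qG v.
Proof. by exists (quot_rep x); rewrite -[LHS](quot_repK x). Qed.

Lemma merge_surje d : exists e, d = he qG e.
Proof. by exists (quot_rep d); rewrite -[LHS](quot_repK d). Qed.

Lemma merge_identifies : qG b = qG b'.
Proof.
(* The loop at [b] puts [b] itself into [Bup b], so the coequaliser relates it to its image [b']. *)
have [hb _ _ _] := m; have Pb : sv (Bup b) b := bang_refl pG hb.
have := coeq_in_eq (hat1 m) (hat2 pG m).
move/(congr1 (fun l : thom (sub (Bup b)) _ => l (exist _ b Pb))) => /=.
by rewrite Bup_isoE /= swapE.
Qed.

Lemma merge_vE v w : qG v = qG w <-> swap b b' v = swap b b' w.
Proof.
split=> [/quot_inE|].
  elim=> [_ _ [a [<- <-]]|//|? ? _ ->|? ? ? _ -> _ ->] //=.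
  by rewrite Bup_isoE swap_id.
have bb := merge_identifies.
by move=> /swap_eq[->|[-> ->]|[-> ->]].
Qed.

Lemma merge_v_nbang v w : ~ bangs G v -> qG v = qG w -> v = w.
Proof.
have [hb hb' _ _] := m.
by move=> nv /merge_vE/swap_eq[//|[E _]|[E _]]; case: nv; rewrite E.
Qed.

(** Generating identifications only involve edges of [Bup b] and their images, all of which join
    !-vertices. *)
Lemma merge_e_nbang d e : ~ bangs G (tgt d) -> he qG d = he qG e -> d = e.
Proof.
have hb : bangs G b by case: m.
suff : forall d e, clos_refl_sym_trans _ (coeq_rele (hat1 m) (hat2 pG m)) d e ->
    d = e \/ bangs G (tgt d) /\ bangs G (tgt e).
  by move=> h nd /quot_inE/h[//|[/nd]].
move=> {}d {}e; elim=> {d e}.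
- move=> _ _ [a [<- <-]]; right; rewrite !hom_tgt !bangs_hom.
  by have := preds_bangs hb (svalP (tgt a)).
- by left.
- by move=> ? ? _ [->|[? ?]]; [left|right].
- by move=> ? ? ? _ [->|[? ?]] _ [<-|[? ?]]; [left|right|right|right].
Qed.

(** The isomorphism from [Bup b] to [Bup b'] carries [d] to another representative of its class;
    this moves targets from [b] to [b']. *)
Lemma merge_twin d : tgt d = b ->
  exists d', [/\ he qG d' = he qG d, src d' = swap b b' (src d) & tgt d' = b'].
Proof.
have [hb _ _ _] := m => dt.
have Pd : se (Bup b) d.
  by split; [exists d|rewrite dt; exact: bang_refl].
pose a : edge (@sub G3 G (Bup b)) := exist _ d Pd.
exists (sval (he (Bup_iso pG m) a)); split.
- exact: (congr1 (fun l : thom (sub (Bup b)) _ => he l a)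
    (esym (coeq_in_eq (hat1 m) (hat2 pG m)))).
- by have /(congr1 sval) := hom_src (Bup_iso pG m) a; rewrite Bup_isoE.
- by have /(congr1 sval) := hom_tgt (Bup_iso pG m) a; rewrite Bup_isoE /= dt swapE.
Qed.

(** Passing to twins makes the targets equal. The sources then cannot be [b] and [b'], as the common
    target would lie in two disjoint boxes, so the two edges are parallel in [G]. *)
Lemma merge_e_bang d e : bangs G (tgt d) ->
  qG (src d) = qG (src e) -> qG (tgt d) = qG (tgt e) -> he qG d = he qG e.
Proof.
have core d0 e0 : bangs G (tgt d0) -> swap b b' (src d0) = swap b b' (src e0) ->
    tgt d0 = tgt e0 -> he qG d0 = he qG e0.
  move=> hd /swap_eq[Es|[Ed Ee]|[Ed Ee]] Et.
  - by rewrite (bang_edge_eq pG hd Es Et).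
  - case: (@mergable_disjoint (tgt d0)); first by exists d0.
    by exists e0; rewrite Et.
  - case: (@mergable_disjoint (tgt d0)); last by exists d0.
    by exists e0; rewrite Et.
have [hb hb' _ _] := m.
move=> hd /merge_vE Es /merge_vE/swap_eq[|[/merge_twin[d' [<- Es' dt']] et]|
  [dt /merge_twin[e' [<- Es' et']]]]; first exact: core.
- by apply: core; rewrite ?dt' ?Es' ?swap_id.
- by apply: core; rewrite ?et' ?Es' ?swap_id.
Qed.

Lemma merge_edge v w : edge_rel (qG v) (qG w) <->
  exists v' w', [/\ qG v' = qG v, qG w' = qG w & edge_rel v' w'].
Proof.
split=> [[d]|[v' [w' [<- <- [e [<- <-]]]]]]; last first.
  by exists (he qG e); rewrite hom_src hom_tgt.
have [e ->] := merge_surje d; rewrite hom_src hom_tgt => -[ev ew].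
by exists (src e), (tgt e); split=> //; exists e.
Qed.

(* [b] and [b'] have the same predecessors, hence edges of the quotient lift
   along any choice of representative of the target. *)
Lemma merge_lift_tgt u v w : edge_rel u v -> qG v = qG w ->
  exists2 u', qG u' = qG u & edge_rel u' w.
Proof.
have [hb hb' _ _] := m; have m' := mergable_sym m.
move=> uv /merge_vE/swap_eq[<-|[E ->]|[E ->]]; first by exists u.
- rewrite E in uv; case: (pselect (u = b)) => [->|nu].
    by exists b'; [rewrite merge_identifies|exact: bang_refl].
  by exists u => //; case: (mergable_preds m uv nu).
- rewrite E in uv; case: (pselect (u = b')) => [->|nu].
    by exists b; [rewrite merge_identifies|exact: bang_refl].
  by exists u => //; case: (mergable_preds m' uv nu).
Qed.

Lemma merge_pattern : pattern_data (MERGE pG m).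
Proof.
have [si so uE rE aE tE oi oo] := (pattern_graphP G).1 pG.
split.
- move=> x y; have [d ->] := merge_surje x; have [e ->] := merge_surje y.
  rewrite !hom_src !hom_tgt !omegas_hom !bangs_hom => hd nd ne.
  by move=> /(merge_v_nbang (omegas_nbang hd)) E; congr he; apply: si.
- move=> x y; have [d ->] := merge_surje x; have [e ->] := merge_surje y.
  rewrite !hom_src !omegas_hom => hd.
  by move=> /(merge_v_nbang (omegas_nbang hd)) E; congr he; apply: so.
- move=> x y; have [d ->] := merge_surje x; have [e ->] := merge_surje y.
  by rewrite !hom_src !hom_tgt !bangs_hom; apply: merge_e_bang.
- move=> x; have [v ->] := merge_surjv x; rewrite bangs_hom => hv.
  by apply/merge_edge; exists v, v; split=> //; apply: rE.
- move=> x y; have [v ->] := merge_surjv x; have [w ->] := merge_surjv y.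
  rewrite bangs_hom => hw /merge_edge[v1 [w1 [Ev1 Ew1 vw]]].
  move=> /merge_edge[w2 [v2 [Ew2 Ev2 wv]]].
  (* The cycle in the quotient lifts to a path from [w3] through [v3] to [w2] in [G], whose ends
     have the same class. *)
  have [v3 Ev3 vw2] := merge_lift_tgt vw (etrans Ew1 (esym Ew2)).
  have Ev : qG v3 = qG v by rewrite Ev3.
  have [w3 Ew3 wv3] := merge_lift_tgt wv (etrans Ev2 (esym Ev)).
  have hw2 : bangs G w2 by apply/(bangs_hom qG); rewrite Ew2; apply/bangs_hom.
  have hv3 := preds_bangs hw2 vw2.
  have ww : edge_rel w3 w2 by apply: tE wv3 vw2.
  have ww2 := rE _ hw2.
  (* Equal ends give a cycle in [G], settled by antisymmetry. Otherwise they are [b] and [b'], and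
     [w2] lies in both boxes through the composite edge and its own loop, against disjointness. *)
  move: Ew3 => /merge_vE/swap_eq[E|[E3 E2]|[E3 E2]].
  + by rewrite -Ev -Ew2; congr (hv qG _); apply: aE => //; rewrite -E.
  + by rewrite E3 E2 in ww ww2; case: (mergable_disjoint ww).
  + by rewrite E3 E2 in ww ww2; case: (mergable_disjoint ww2).
- move=> x y z; have [u ->] := merge_surjv x; have [v ->] := merge_surjv y.
  have [w ->] := merge_surjv z; rewrite bangs_hom => hv.
  move=> /merge_edge[u1 [v1 [Eu1 Ev1 uv]]] /merge_edge[v2 [w2 [Ev2 Ew2 vw]]].
  have [u3 Eu3 uv2] := merge_lift_tgt uv (etrans Ev1 (esym Ev2)).
  have hv2 : bangs G v2 by apply/(bangs_hom qG); rewrite Ev2; apply/bangs_hom.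
  apply/merge_edge; exists u3, w2; split=> //; first by rewrite Eu3.
  exact: tE vw.
- move=> x y; have [c ->] := merge_surjv x; have [e ->] := merge_surje y.
  rewrite !hom_src !hom_tgt !omegas_hom !bangs_hom => hc ht ns.
  (* The endpoint outside the !-vertices has a unique representative, so only [c] may have to be
     replaced, by [c1]. *)
  move=> /merge_edge[c1 [s [Ec /esym/(merge_v_nbang ns) <- cs]]].
  apply/merge_edge; exists c1, (tgt e); split=> //; apply: oi => //.
  by apply/(bangs_hom qG); rewrite Ec; apply/bangs_hom.
- move=> x y; have [c ->] := merge_surjv x; have [e ->] := merge_surje y.
  rewrite !hom_src !hom_tgt !omegas_hom !bangs_hom => hc hs.
  have nt := nbang_tgt (omegas_nbang hs).
  move=> /merge_edge[c1 [s [Ec /esym/(merge_v_nbang nt) <- cs]]].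
  apply/merge_edge; exists c1, (src e); split=> //; apply: oo => //.
  by apply/(bangs_hom qG); rewrite Ec; apply/bangs_hom.
Qed.

Lemma In_merge v : In (MERGE pG m) (qG v) <-> In G v.
Proof.
apply: In_lift => x hv; have [e ->] := merge_surje x.
rewrite hom_src hom_tgt bangs_hom => /esym/(merge_v_nbang (omegas_nbang hv)) -> ns.
by exists e.
Qed.

Lemma Out_merge v : Out (MERGE pG m) (qG v) <-> Out G v.
Proof.
apply: Out_lift => x hv; have [e ->] := merge_surje x.
by rewrite hom_src => /esym/(merge_v_nbang (omegas_nbang hv)) ->; exists e.
Qed.

Lemma Bound_merge v : Bound (MERGE pG m) (qG v) <-> Bound G v.
Proof. by rewrite /Bound /setU /= In_merge Out_merge. Qed.

Lemma point_merge : point_graph (Sigma G) -> point_graph (Sigma (MERGE pG m)).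
Proof.
move=> /point_SigmaP[pv pe]; apply/point_SigmaP; split=> [x|d].
- have [v ->] := merge_surjv x; rewrite sigma_hom omegas_hom; exact: pv.
- by have [e ->] := merge_surje d; rewrite hom_src bangs_hom; exact: pe.
Qed.

End Merge.

(** * Legs under MERGE *)

Section MergeLeg.
Variables (G H : tgraph G3) (f : thom G H) (isof : graph_iso (beta_map f)).
Variables (pG : pattern_graph G) (pH : pattern_graph H) (b b' : vert G).
Variables (m : mergable b b') (mf : mergable (f b) (f b')).

Lemma merge_map_in v :
  merge_map isof pG pH m mf (merge_in pG m v) = merge_in pH mf (f v).
Proof.
have := (merge_mapP isof (merge_map isof pG pH m mf)).2 erefl.
by move/(congr1 (fun l : thom G _ => l v)).
Qed.

Lemma leg_merge : leg_data f -> leg_data (merge_map isof pG pH m mf).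
Proof.
move=> [fi fb fs sB fr].
have fswap v : swap (f b) (f b') (f v) = f (swap b b' v).
  case: (pselect (v = b)) => [->|nv]; first by rewrite !swapE.
  by rewrite !swapN // => /fi.
(* The class of [f v] stays within the image of [f]: apart from [f v] itself it can only contain
   [f b] and [f b']. *)
have fpull y v : merge_in pH mf y = merge_in pH mf (f v) ->
    exists2 v', f v' = y & merge_in pG m v' = merge_in pG m v.
  move=> /merge_vE E.
  suff [v' E'] : exists v', f v' = y.
    exists v' => //; apply/merge_vE; apply: fi.
    by rewrite -!fswap E'.
  by move: E => /swap_eq[->|[-> _]|[-> _]]; [exists v|exists b|exists b'].
split.
- move=> x y; have [v ->] := merge_surjv x; have [w ->] := merge_surjv y.
  by rewrite !merge_map_in => /merge_vE; rewrite !fswap => /fi E; apply/merge_vE.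
- move=> y; have [w ->] := merge_surjv y; rewrite bangs_hom => /fb[v <-].
  by exists (merge_in pG m v); rewrite merge_map_in.
- move=> y; have [w ->] := merge_surjv y; move=> /Bound_merge/fs[v <-].
  by exists (merge_in pG m v); rewrite merge_map_in.
- move=> x; have [v ->] := merge_surjv x; rewrite sigma_hom => /sB hv.
  by rewrite merge_map_in; apply/Bound_merge.
- move=> x y; have [c ->] := merge_surjv x; have [v ->] := merge_surjv y.
  rewrite bangs_hom !merge_map_in => hc /merge_edge[_ [_ [/fpull[c1 <- Ec] /fpull[v1 <- Ev] cv]]].
  apply/merge_edge; exists c1, v1; split=> //; apply: fr => //.
  by apply/(bangs_hom (merge_in pG m)); rewrite Ec; apply/bangs_hom.
Qed.

End MergeLeg.

Lemma PMERGE_rewrite_pattern (S : span) (rS : rewrite_pattern S)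
  (b b' : vert (apex S)) (m : mergable b b')
  (m1 : mergable (leg1 S b) (leg1 S b')) (m2 : mergable (leg2 S b) (leg2 S b')) :
  rewrite_pattern (PMERGE rS m m1 m2).
Proof.
have [_ pt l1 l2 io] := (rewrite_patternP S).1 rS.
apply/rewrite_patternP; split.
- by split; exact: merge_pattern.
- exact: point_merge.
- exact: leg_merge.
- exact: leg_merge.
- move=> p; have [v ->] := merge_surjv p.
  cbn [apex lhs rhs leg1 leg2 PMERGE]; rewrite sigma_hom !merge_map_in.
  by move=> /io; rewrite !In_merge !Out_merge.
Qed.

Theorem theorem5p8 (S : span) (rS : rewrite_pattern S) :
  (forall (b : vert (apex S)) (hb : bangs (apex S) b), rewrite_pattern (PCOPY rS hb)) /\
  (forall (b : vert (apex S)) (hb : bangs (apex S) b), rewrite_pattern (PDROP rS hb)) /\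
  (forall (b : vert (apex S)) (hb : bangs (apex S) b), rewrite_pattern (PKILL rS hb)) /\
  (forall (b b' : vert (apex S)) (m : mergable b b')
     (m1 : mergable (leg1 S b) (leg1 S b'))
     (m2 : mergable (leg2 S b) (leg2 S b')),
     rewrite_pattern (PMERGE rS m m1 m2)).
Proof.
split; first exact: PCOPY_rewrite_pattern.
split; first exact: PDROP_rewrite_pattern.
by split; [exact: PKILL_rewrite_pattern|exact: PMERGE_rewrite_pattern].
Qed.
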